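(* Fix $N\ge1$ and let $g\in SO(N)$ be Haar-distributed. Then for every $K\ge1$, \[\mathbb{P}\big[|gT\cap\mathbb{Z}^N|\ge K\big]\lesssim K^{-N},\] uniformly over all convex subsets $T\subset\mathbb{R}^N$ with $|T|\lesssim1$, where implied constants depend only on $N$.
   Context: $|T|$ denotes Lebesgue measure and $|gT\cap\mathbb{Z}^N|$ the number of integer points in the rotated set $gT$. *)

(* Defs.v *)
From HB Require Import structures.
From mathcomp Require Import all_boot all_order all_algebra.
From mathcomp Require Import all_classical all_reals all_analysis.
Set Implicit Arguments. Unset Strict Implicit. Unset Printing Implicit Defensive.
Import Order.TTheory GRing.Theory Num.Theory.
Local Open Scope classical_set_scope.
Local Open Scope ring_scope.

Definition SOset (R : realType) (N : nat) : set 'M[R]_N :=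
  [set M | M *m M^T = 1%:M /\ \det M = 1].

Definition convexRN (R : realType) (N : nat) (T : set 'cV[R]_N) : Prop :=
  forall x y (t : R), T x -> T y -> 0 <= t -> t <= 1 ->
    T (t *: x + (1 - t) *: y).

Definition box (R : realType) (N : nat) (a b : 'cV[R]_N) : set 'cV[R]_N :=
  [set x | forall i, a i 0 <= x i 0 <= b i 0].
Definition box_vol (R : realType) (N : nat) (a b : 'cV[R]_N) : R :=
  \prod_(i < N) Num.max (b i 0 - a i 0) 0.

(* N-dimensional Lebesgue (outer) measure |T|: infimum of total volumes of
   countable box covers.  Coincides with Lebesgue measure on measurable sets
   (in particular on convex sets). *)
Definition lebesgue_outerRN (R : realType) (N : nat) (T : set 'cV[R]_N)
  : \bar R :=
  ereal_inf [set s : \bar R | exists a b : nat -> 'cV[R]_N,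
     T `<=` \bigcup_k box (a k) (b k) /\
     s = (\sum_(0 <= k <oo) (box_vol (a k) (b k))%:E)%E].

Definition is_lattice_pt (R : realType) (N : nat) (z : 'cV[R]_N) : Prop :=
  forall i, z i 0 \is a Num.int.

Definition rotset (R : realType) (N : nat) (g : 'M[R]_N) (T : set 'cV[R]_N)
  : set 'cV[R]_N := [set g *m v | v in T].

(* |gT ∩ Z^N| >= K  (cardinality possibly infinite): there are at least K
   distinct lattice points in gT. *)
Definition many_lattice_pts (R : realType) (N : nat) (g : 'M[R]_N)
  (T : set 'cV[R]_N) (K : R) : Prop :=
  exists s : seq 'cV[R]_N, uniq s /\ K <= (size s)%:R /\
    forall z, z \in s -> is_lattice_pt z /\ rotset g T z.

Definition haar_SO (R : realType) (N : nat) (d : measure_display)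
  (Omega : measurableType d) (P : probability Omega R)
  (g : Omega -> 'M[R]_N) : Prop :=
  [/\ forall w, SOset (g w),
      forall i j, measurable_fun setT (fun w => g w i j) &
      forall h, SOset h ->
        forall B : 'I_N -> 'I_N -> set R, (forall i j, measurable (B i j)) ->
          P [set w | forall i j, B i j (g w i j)] =
          P [set w | forall i j, B i j ((h *m g w) i j)]].

(* Main.v *)
(* Suppose that g T contains K lattice points.  If K exceeds a constant, they span a
   sublattice L of rank 0 < k < N, and if W is a matrix of determinant O(1) such that
   a translate of T lies in the image under W of a cube, then the covolume of
   W^-1 g^-1 L is O(1/K).  The law of covol (W^-1 g^-1 L) / covol L does not depend
   on L, because SO(N) acts transitively on k-dimensional subspaces; call its inverse
   rho.  Reduction theory shows that any lattice of covolume 1 has O(Y^N) sublattices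
   of rank k and of covolume at most Y (for the lattice W^-1 g^-1 Z^N this needs Y
   large, or no short vectors in the sublattices), and a diagonally dominant family
   shows that Z^N has at least a constant times X^N of them.  Hence the expected
   number of L with covol (W^-1 g^-1 L) <= y is O(y^N E[rho^N]), while comparing the
   two counts at one large scale Y gives Y^N E[rho^N] = O(Y^N), so that E[rho^N] = O(1):
   no integration over SO(N) or over R^N is needed.

   The matrix W comes from a simplex of almost maximal volume in T.  Its volume is
   bounded by the outer measure of T by counting the points of a fine lattice in each
   box of a finite cover. *)

Require Import Defs.
From HB Require Import structures.
From mathcomp Require Import all_boot all_order all_algebra.
From mathcomp Require Import all_classical all_reals all_analysis measurable_realfun.
From mathcomp Require Import ring lra zify.
Import Order.TTheory GRing.Theory Num.Theory numFieldNormedType.Exports.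
Local Open Scope classical_set_scope.
Local Open Scope ring_scope.
Set Implicit Arguments. Unset Strict Implicit. Unset Printing Implicit Defensive.

(** * Gram determinants and orthogonal reduction *)

Section Gram.
Variable R : realType.

(** [gram] is the square of a covolume, so most estimates are proved in squared form. One obstacle
    is to reach the exponent [N] without logarithms. Bounding the sublattices by the choices of
    reduced basis vectors, sorted by dyadic length, would cost a power of log Y, because many length
    patterns share the same product. The loss is recovered because a sublattice whose first basis
    vector is much shorter than the others has many bases of the same dyadic lengths, and dividing
    by their number makes the sum over patterns geometric.

    The other obstacle is uniformity in T: only the determinant of [W] is controlled, not its shape.
    Counts in the lattice pulled back by [W] have uniform constants only above a length that depends
    on [W]. Hence the scale Y is chosen after [W], and the family in Z^N must avoid all vectors
    shorter than a length prescribed by [W]; these thresholds cancel from the final constant. *)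

Definition gram (n k : nat) (X : 'M[R]_(n, k)) : R := \det (X^T *m X).

Definition sqn (n : nat) (x : 'cV[R]_n) : R := \sum_i x i 0 ^+ 2.

Lemma sqnE n (x : 'cV[R]_n) : x^T *m x = (sqn x)%:M.
Proof.
apply/matrixP => i j; rewrite !ord1 !mxE mulr1n; apply: eq_bigr => l _.
by rewrite mxE expr2.
Qed.

Lemma sqn_ge0 n (x : 'cV[R]_n) : 0 <= sqn x.
Proof. by apply: sumr_ge0 => i _; apply: sqr_ge0. Qed.

Lemma sqn_eq0 n (x : 'cV[R]_n) : (sqn x == 0) = (x == 0).
Proof.
apply/eqP/eqP => [/eqP|->]; last by rewrite /sqn big1// => i _; rewrite mxE expr0n.
rewrite psumr_eq0; last by move=> i _; apply: sqr_ge0.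
move=> /allP h; apply/matrixP => i j; rewrite ord1 mxE.
by have := h i; rewrite mem_index_enum /= sqrf_eq0 => /(_ isT)/eqP.
Qed.

Lemma sqn_orth n m (Q : 'M[R]_(m, n)) (x : 'cV[R]_n) :
  Q^T *m Q = 1%:M -> sqn (Q *m x) = sqn x.
Proof.
move=> hQ; have : ((Q *m x)^T *m (Q *m x)) 0 0 = (x^T *m x) 0 0.
  by rewrite trmx_mul -mulmxA (mulmxA Q^T) hQ mul1mx.
by rewrite !sqnE !mxE !mulr1n.
Qed.

Lemma sqnZ n a (x : 'cV[R]_n) : sqn (a *: x) = a ^+ 2 * sqn x.
Proof. by rewrite /sqn mulr_sumr; apply: eq_bigr => i _; rewrite mxE exprMn. Qed.

Lemma entry_le_sqn n (x : 'cV[R]_n) i : x i 0 ^+ 2 <= sqn x.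
Proof.
by rewrite /sqn (bigD1 i)//= lerDl sumr_ge0// => j _; apply: sqr_ge0.
Qed.

Lemma gram_orth n m k (Q : 'M[R]_(m, n)) (X : 'M[R]_(n, k)) :
  Q^T *m Q = 1%:M -> gram (Q *m X) = gram X.
Proof. by move=> hQ; rewrite /gram trmx_mul -mulmxA (mulmxA Q^T) hQ mul1mx. Qed.

Lemma gramM n k (X : 'M[R]_(n, k)) (S : 'M[R]_k) :
  gram (X *m S) = gram X * \det S ^+ 2.
Proof.
rewrite /gram trmx_mul !mulmxA -(mulmxA _ X^T) !det_mulmx det_tr; ring.
Qed.

Lemma gram_sq n (X : 'M[R]_n) : gram X = \det X ^+ 2.
Proof. by rewrite /gram det_mulmx det_tr expr2. Qed.

Lemma gram_col_mx0 k m (S : 'M[R]_k) : gram (col_mx S (0 : 'M[R]_(m, k))) = \det S ^+ 2.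
Proof.
by rewrite /gram tr_col_mx mul_row_col trmx0 mul0mx addr0 det_mulmx det_tr expr2.
Qed.

Lemma gram_inj n k l (X : 'M[R]_(n, k)) (c c' : 'M[R]_(k, l)) :
  gram X != 0 -> X *m c = X *m c' -> c = c'.
Proof.
move=> h /(congr1 (mulmx X^T)); rewrite !mulmxA.
have hu : X^T *m X \in unitmx by rewrite unitmxE unitfE.
by move=> /(congr1 (mulmx (invmx (X^T *m X)))); rewrite !mulKmx.
Qed.

Lemma gram_eq0P n k (X : 'M[R]_(n, k)) :
  gram X = 0 -> exists2 c : 'cV[R]_k, c != 0 & X *m c = 0.
Proof.
move=> /eqP /det0P [v v0 hv]; exists v^T.
  by apply: contraNneq v0 => /(congr1 trmx); rewrite trmxK trmx0 => ->.
apply/eqP; rewrite -sqn_eq0; apply/eqP.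
have : ((X *m v^T)^T *m (X *m v^T)) 0 0 = 0.
  by rewrite trmx_mul trmxK -mulmxA (mulmxA X^T) mulmxA hv mul0mx mxE.
by rewrite sqnE !mxE mulr1n.
Qed.

Lemma col_mulmx (K : nzRingType) n m k (A : 'M[K]_(n, m)) (B : 'M[K]_(m, k)) j :
  col j (A *m B) = A *m col j B.
Proof. by rewrite !colE mulmxA. Qed.

Lemma householder n (x : 'cV[R]_n.+1) : exists Q : 'M[R]_n.+1,
  Q^T *m Q = 1%:M /\ Q *m x = Num.sqrt (sqn x) *: delta_mx 0 0.
Proof.
pose y : 'cV[R]_n.+1 := Num.sqrt (sqn x) *: delta_mx 0 0.
have yy : sqn y = sqn x.
  rewrite /y sqnZ sqr_sqrtr ?sqn_ge0//.
  suff -> : sqn (delta_mx 0 0 : 'cV[R]_n.+1) = 1 by rewrite mulr1.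
  rewrite /sqn big_ord_recl !mxE !eqxx expr1n.
  by rewrite big1 ?addr0// => i _; rewrite mxE expr0n.
have [-> | xy] := eqVneq x y.
  exists 1%:M; rewrite trmx1 mul1mx; split => //; rewrite mul1mx.
  by rewrite [in RHS]yy.
pose u := x - y.
have uu : sqn u != 0 by rewrite sqn_eq0 subr_eq0.
pose s := sqn u.
pose Q : 'M[R]_n.+1 := 1%:M - (2 / s) *: (u *m u^T).
have QT : Q^T = Q.
  by rewrite /Q linearB/= trmx1 linearZ/= trmx_mul trmxK.
exists Q; split.
  have uuu : (u *m u^T) *m (u *m u^T) = s *: (u *m u^T).
    by rewrite -mulmxA (mulmxA u^T) sqnE mul_scalar_mx -scalemxAr.
  rewrite QT {1}/Q mulmxBl mul1mx -scalemxAl /Q mulmxBr mulmx1 -scalemxAr uuu.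
  have s0 : s != 0 := uu.
  move: (u *m u^T) => V; apply/matrixP => i j; rewrite !mxE.
  by move: (V i j) (_ *+ (i == j)) s0; move: (s) => r z o r0; field.
(* with |x| = |y|, one has <x-y, x> = |x-y|^2 / 2 *)
have yx : (y^T *m x) 0 0 = (x^T *m y) 0 0.
  by rewrite !mxE; apply: eq_bigr => i _; rewrite !mxE mulrC.
have uT : u^T = x^T - y^T by rewrite /u raddfB.
have subE (A B : 'M[R]_1) : (A - B) 0 0 = A 0 0 - B 0 0 by rewrite !mxE.
have ux : u^T *m x = (s / 2)%:M.
  apply/matrixP => i j; rewrite !ord1 [RHS]mxE mulr1n.
  have -> : s = (u^T *m u) 0 0 by rewrite sqnE mxE mulr1n.
  have -> : (u^T *m u) 0 0 = (x^T *m x) 0 0 - (x^T *m y) 0 0 - (y^T *m x) 0 0 + (y^T *m y) 0 0.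
    rewrite uT /u mulmxBl !mulmxBr !subE; lra.
  have -> : (u^T *m x) 0 0 = (x^T *m x) 0 0 - (y^T *m x) 0 0.
    by rewrite uT mulmxBl subE.
  rewrite yx !sqnE !mxE !mulr1n yy; lra.
rewrite /Q mulmxBl mul1mx -scalemxAl -mulmxA ux mul_mx_scalar scalerA.
rewrite (_ : 2 / s * (s / 2) = 1) ?scale1r; last by rewrite /s; field.
by rewrite /u opprB addrC subrK.
Qed.

(** Elimination of one column. The sizes are written [1 + m] and [1 + k] so that [qr] can recurse on
    the lower right block. *)
Lemma householder_block m k (X : 'M[R]_(1 + m, 1 + k)) :
  exists (H : 'M[R]_(1 + m)) (r : 'rV[R]_k) (Y : 'M[R]_(m, k)),
  H^T *m H = 1%:M /\ H *m X = block_mx (Num.sqrt (sqn (col 0 X)))%:M r 0 Y.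
Proof.
have [H [HH Hx]] := householder (col 0 X : 'cV[R]_m.+1).
pose b := Num.sqrt (sqn (col 0 X)).
pose Y : 'M[R]_(1 + m, 1 + k) := H *m X.
have Y0 : lsubmx Y = col_mx b%:M 0.
  transitivity (col (0 : 'I_k.+1) Y).
    apply/matrixP => i j; rewrite !mxE; apply: eq_bigr => l _.
    by congr (_ * X _ _); apply: val_inj; rewrite /= ord1.
  rewrite /Y col_mulmx Hx.
  apply/matrixP => i j; rewrite ord1 !mxE; case: splitP => l hl; rewrite !mxE.
    by rewrite ord1 in hl *; rewrite (_ : i = 0) ?eqxx ?mulr1//; apply: val_inj.
  by rewrite (_ : (i == 0) = false) ?mulr0//; apply/negbTE/eqP => i0; rewrite i0 in hl.
exists H, (ursubmx Y), (drsubmx Y); split => //.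
move: Y0; rewrite -{1}(submxK Y) block_mxEh row_mxKl => /eq_col_mx [u1 d1].
by rewrite -/Y -[LHS]submxK u1 d1.
Qed.

(** With n = k + m, this turns later statements on n by k matrices into statements on the square
    matrix [S]. *)
Lemma qr k m (X : 'M[R]_(k + m, k)) : exists (Q : 'M[R]_(k + m)) (S : 'M[R]_k),
  [/\ Q^T *m Q = 1%:M, Q *m X = col_mx S 0 &
      forall i j : 'I_k, (j < i)%N -> S i j = 0].
Proof.
elim: k X => [|k IH] X.
  exists 1%:M, 0; split; rewrite ?trmx1 ?mulmx1//; last by case.
  by apply/matrixP => i [].
have [H [r [Y [HH HX]]]] := @householder_block (k + m) k X.
set b := Num.sqrt _ in HX.
have [Q' [S' [QQ QX tri]]] := IH Y.
pose Q1 : 'M[R]_(1 + (k + m)) := block_mx 1%:M 0 0 Q'.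
exists (Q1 *m H), (block_mx b%:M r 0 S'); split.
- rewrite trmx_mul -mulmxA (mulmxA Q1^T).
  suff -> : Q1^T *m Q1 = 1%:M by rewrite mul1mx HH.
  rewrite /Q1 tr_block_mx mulmx_block !trmx0 !trmx1 !mul0mx !mulmx0 !mul1mx QQ.
  by rewrite !addr0 add0r -scalar_mx_block.
- have E : Q1 *m (H *m X) = block_mx b%:M r 0 (col_mx S' 0).
    transitivity (Q1 *m block_mx b%:M r 0 Y); first by congr (_ *m _); exact: HX.
    by rewrite /Q1 mulmx_block !mul1mx !mul0mx !mulmx0 !addr0 !add0r QX.
  transitivity (Q1 *m (H *m X)); first by rewrite mulmxA.
  rewrite E.
  apply/matrixP => i j; rewrite !mxE.
  case: (splitP (i : 'I_(1 + (k + m)))) => i1 hi1.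
    case: (splitP (i : 'I_(1 + k + m))) => i2 hi2; rewrite !mxE.
      case: (splitP (i2 : 'I_(1 + k))) => i3 hi3; last first.
        by move: (ltn_ord i1); rewrite -hi1 hi2 hi3.
      have -> : i1 = i3 by rewrite !ord1.
      by rewrite mxE.
    by move: (ltn_ord i1); rewrite -hi1 hi2; lia.
  rewrite !mxE.
  case: (splitP (i : 'I_(1 + k + m))) => i2 hi2.
    rewrite !mxE; case: (splitP (i2 : 'I_(1 + k))) => i3 hi3.
      by move: (ltn_ord i3); rewrite -hi3 -hi2 hi1.
    have e13 : (1 + i3 = 1 + i1)%N := etrans (esym hi3) (etrans (esym hi2) hi1).
    rewrite [RHS]mxE; case: splitP => j1 hj1; first by rewrite !mxE.
    rewrite mxE; case: splitP => i4 hi4.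
      by congr (S' _ _); apply: val_inj; move: e13 hi4 => /=; lia.
    by move: (ltn_ord i3) e13 hi4; lia.
  rewrite !mxE; case: splitP => j1 hj1; rewrite !mxE//.
  case: splitP => i3 hi3; last by rewrite mxE.
  have e12 : (1 + k + i2 = 1 + i1)%N := etrans (esym hi2) hi1.
  by move: (ltn_ord i3) e12 hi3; lia.
- move=> i j ji; rewrite mxE; case: splitP => i1 hi1.
    have ei : nat_of_ord i = i1 := hi1.
    by move: (ltn_ord i1) ei; lia.
  rewrite mxE; case: splitP => j1 hj1; first by rewrite mxE.
  have ei : (nat_of_ord i = 1 + i1)%N := hi1.
  have ej : (nat_of_ord j = 1 + j1)%N := hj1.
  by apply: tri; lia.
Qed.

Lemma det_upper k (S : 'M[R]_k) : (forall i j : 'I_k, (j < i)%N -> S i j = 0) ->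
  \det S = \prod_i S i i.
Proof.
move=> h; rewrite -det_tr det_trig; first by apply: eq_bigr => i _; rewrite mxE.
by apply/is_trig_mxP => i j ij; rewrite mxE h.
Qed.

(** After the rotation of [qr], the Gram determinant is the product of the squared diagonal entries
    of [S], and each entry is one coordinate of a rotated column, whose length has not changed. *)
Lemma hadamard n k (X : 'M[R]_(n, k)) : (k <= n)%N ->
  gram X <= \prod_j sqn (col j X).
Proof.
move=> kn; have En : n = (k + (n - k))%N by lia.
move: (n - k)%N En => m En; subst n.
have [Q [S [QQ QX tri]]] := qr X.
rewrite -(gram_orth X QQ) QX gram_col_mx0 det_upper// -prodrXl.
apply: ler_prod => j _; rewrite sqr_ge0 /=.
rewrite -(sqn_orth _ QQ) -col_mulmx QX.
apply: le_trans (entry_le_sqn _ (lshift m j)).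
by rewrite mxE col_mxEu.
Qed.

Lemma gram_ge0 n k (X : 'M[R]_(n, k)) : (k <= n)%N -> 0 <= gram X.
Proof.
move=> kn; have En : n = (k + (n - k))%N by lia.
move: (n - k)%N En => m En; subst n.
have [Q [S [QQ QX tri]]] := qr X.
by rewrite -(gram_orth X QQ) QX gram_col_mx0 sqr_ge0.
Qed.

End Gram.

(** * Counting lattice points *)

Section LatticePoints.
Variable R : realType.
Local Notation toR := (map_mx (@intmul R 1)).

Lemma gram_neq0_leq n k (X : 'M[R]_(n, k)) : gram X != 0 -> (k <= n)%N.
Proof.
move=> h; have : X^T *m X \in unitmx by rewrite unitmxE unitfE.
rewrite -row_full_unit /row_full => /eqP <-.
by apply: leq_trans (mxrankM_maxr _ _) _; apply: rank_leq_row.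
Qed.

(** Cramer's rule, in the form used by both maximality arguments: multiplying on the right by this
    matrix replaces the [i]-th column by the combination with coefficients [c]. *)
Lemma det_id_replace_col k (c : 'cV[R]_k) (i : 'I_k) :
  \det (\matrix_(a, b) if b == i then c a 0 else (a == b)%:R) = c i 0.
Proof.
rewrite (expand_det_row _ i) (bigD1 i)//= mxE eqxx big1 ?addr0; last first.
  by move=> j ji; rewrite mxE (negbTE ji) eq_sym (negbTE ji) mul0r.
rewrite /cofactor -signr_odd oddD addbb expr0 mul1r.
set M := row' _ _; suff -> : M = 1%:M by rewrite det1 mulr1.
apply/matrixP => a b; rewrite !mxE.
by rewrite [lift i b == i]eq_sym (negbTE (neq_lift _ _)) (inj_eq lift_inj).
Qed.

(** Take [k] maximal among independent tuples, then [gram] maximal for this [k]. The first choice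
    puts every vector in the span; by the second, exchanging the [i]-th vector for [y l], which
    multiplies [gram] by the square of [c i 0], cannot increase it. *)
Lemma max_gram_tuple n m (y : 'I_m -> 'cV[R]_n) :
  exists k (t : {ffun 'I_k -> 'I_m}),
  let d := \matrix_(i, j) y (t j) i 0 in
  gram d != 0 /\ forall l, exists c : 'cV[R]_k,
    y l = d *m c /\ forall i, `|c i 0| <= 1.
Proof.
pose d k (t : {ffun 'I_k -> 'I_m}) : 'M[R]_(n, k) := \matrix_(i, j) y (t j) i 0.
pose P k := [exists t : {ffun 'I_k -> 'I_m}, gram (d k t) != 0].
have P0 : exists k, P k.
  exists 0%N; apply/existsP; exists [ffun i : 'I_0 => match i with Ordinal _ h => False_rect _ (Bool.diff_false_true h) end].
  by rewrite /gram det_mx00 oner_eq0.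
have Pn k : P k -> (k <= n)%N by move=> /existsP[t /gram_neq0_leq].
case: (ex_maxnP P0 Pn) => k /existsP[t0 ht0] kmax.
pose t := [arg max_(i > t0) gram (d k i)]%O.
have tmax : forall t', gram (d k t') <= gram (d k t).
  by rewrite /t; case: arg_maxP => //= i _ h t'; apply: h.
have kn : (k <= n)%N by apply: gram_neq0_leq ht0.
have dpos : 0 < gram (d k t).
  by apply: lt_le_trans (tmax t0); rewrite lt_def ht0 gram_ge0.
exists k, t; split; first by rewrite gt_eqF.
move=> l.
have [c yc] : exists c : 'cV[R]_k, y l = d k t *m c.
  (* Appending [y l] must create a linear relation, by maximality of [k]. Its last coefficient is
     nonzero, since the columns of [d k t] are independent. *)
  pose t' : {ffun 'I_(k + 1) -> 'I_m} :=
    [ffun j => match fintype.split j with inl j => t j | inr _ => l end].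
  have dt' : d _ t' = row_mx (d k t) (y l).
    apply/matrixP => i j; rewrite !mxE ffunE; case: fintype.split => a; rewrite ?mxE//.
    by rewrite ord1.
  have g0 : gram (d _ t') = 0.
    apply/eqP; apply: contraT => h.
    have : P (k + 1)%N by apply/existsP; exists t'.
    by move=> /kmax; rewrite addn1 ltnn.
  have [e e0 he] := gram_eq0P g0.
  move: he; rewrite dt' -[e]vsubmxK mul_row_col.
  have -> : dsubmx e = ((dsubmx e) 0 0)%:M.
    by apply/matrixP => a b; rewrite !ord1 [RHS]mxE mulr1n.
  rewrite mul_mx_scalar => he.
  have [z|nz] := eqVneq ((dsubmx e) 0 0) 0.
    move: he; rewrite z scale0r addr0 => he.
    have : usubmx e = 0.
      apply: (@gram_inj _ _ _ _ (d k t)); first by rewrite gt_eqF.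
      by rewrite he mulmx0.
    move=> u0; case/eqP: e0; rewrite -[e]vsubmxK u0.
    apply/matrixP => i j; rewrite ord1 !mxE; case: splitP => a _; rewrite ?mxE//.
    by move: z; rewrite ord1 !mxE.
  exists (- ((dsubmx e) 0 0)^-1 *: usubmx e).
  rewrite -scalemxAr; move: he => /eqP; rewrite addr_eq0 => /eqP ->.
  by rewrite scalerN scaleNr opprK scalerA mulVf// scale1r.
exists c; split => // i.
pose t' : {ffun 'I_k -> 'I_m} := [ffun j => if j == i then l else t j].
have E : d k t' = d k t *m (\matrix_(a, b) if b == i then c a 0 else (a == b)%:R).
  apply/matrixP => a b; rewrite !mxE ffunE; case: (b =P i) => [->|/eqP bi].
    by rewrite yc !mxE; apply: eq_bigr => j _; rewrite !mxE eqxx.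
  rewrite (bigD1 b)//= !mxE (negbTE bi) eqxx mulr1 big1 ?addr0// => j jb.
  by rewrite !mxE (negbTE bi) (negbTE jb) mulr0.
have := tmax t'; rewrite E gramM det_id_replace_col.
rewrite -[leRHS]mulr1 ler_pM2l// => h.
by rewrite -(ler_pXn2r (n := 2)) ?nnegrE// real_normK ?num_real// expr1n.
Qed.

(** In the Smith form of [D], the first [k] columns of the left factor form a basis [v] of all
    integer points in the span of [D]. The lattice of [D] has index [|\det U|] in it, and each coset
    has at most 3^k points with all coefficients in [-1, 1]. *)
Lemma coset_count k n (D : 'M[int]_(n, k)) (s : seq 'cV[int]_n) :
  gram (toR D) != 0 -> uniq s ->
  (forall x, x \in s -> exists c : 'cV[R]_k,
     toR x = toR D *m c /\ forall i, `|c i 0| <= 1) ->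
  exists (v : 'M[int]_(n, k)) (U : 'M[int]_k),
    D = v *m U /\ (size s <= 3 ^ k * `|\det U|)%N.
Proof.
move=> gD us hs; have kn := gram_neq0_leq gD.
have [L uL [R' uR [d _ DE]]] := int_Smith_normal_form D.
pose E : 'M[int]_(n, k) := \matrix_(i, j) (i == j :> nat)%:R.
pose dg : 'M[int]_k := \matrix_(i, j) (d`_i *+ (i == j)).
have EdgE : E *m dg = \matrix_(i, j) (d`_i *+ (i == j :> nat)).
  apply/matrixP => i j; rewrite !mxE (bigD1 j)//= !mxE eqxx mulr1n big1 ?addr0.
    by case: eqP => [->|]; rewrite ?mul1r ?mul0r.
  by move=> l lj; rewrite !mxE (negbTE lj) mulr0n mulr0.
pose v := L *m E; pose U := dg *m R'.
have DvU : D = v *m U by rewrite /v /U DE -EdgE !mulmxA.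
exists v, U; split => //.
have detdg : \det dg = \prod_(i < k) d`_i.
  rewrite det_trig; first by apply: eq_bigr => i _; rewrite mxE eqxx mulr1n.
  by apply/is_trig_mxP => i j ij; rewrite mxE; case: eqP ij => [->|//]; rewrite ltnn.
have detU : `|\det U|%N = (\prod_(i < k) `|(d`_i)%R|)%N.
  rewrite /U det_mulmx abszM detdg.
  have -> : `|\det R'|%N = 1%N by move: uR; rewrite unitmxE qualifE/= => /orP[]/eqP->.
  by rewrite muln1; elim/big_rec2: _ => // i a b _ <-; rewrite abszM.
have dn0 i : (i < k)%N -> d`_i != 0.
  move=> ik; apply: contraNneq gD => d0; rewrite DvU map_mxM gramM.
  rewrite det_map_mx /U det_mulmx detdg (bigD1 (Ordinal ik))//=.
  by rewrite d0 !mul0r rmorph0 expr0n mulr0.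
pose nz (x : 'cV[int]_n) (i : 'I_k) : int := (invmx L *m x) (widen_ord kn i) 0.
have /choice[c hc] : forall x, exists c : 'cV[R]_k, x \in s ->
    toR x = toR D *m c /\ forall i, `|c i 0| <= 1.
  move=> x; have [/hs [c ?]|_] := boolP (x \in s); first by exists c.
  by exists 0.
have hnz x : x \in s -> forall i, (nz x i)%:~R = (d`_i)%:~R * (toR R' *m c x) i 0.
  move=> xs i; have [xc _] := hc _ xs.
  have : toR (invmx L *m x) = toR E *m (toR dg *m (toR R' *m c x)).
    rewrite map_mxM xc DE -EdgE !map_mxM !mulmxA -map_mxM mulVmx//.
    by rewrite map_mx1 mul1mx.
  move: (toR R' *m c x) => y.
  move=> /matrixP /(_ (widen_ord kn i) 0); rewrite mxE -/(nz x i) => ->.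
  rewrite mxE (bigD1 i)//= !mxE eqxx mul1r (bigD1 i)//= !mxE eqxx mulr1n.
  rewrite big1 ?addr0; last first.
    by move=> j ji; rewrite !mxE eq_sym (negbTE ji) mulr0n mul0r.
  rewrite big1 ?addr0// => j ji; rewrite !mxE.
  by rewrite [_ == _](_ : _ = false) ?mul0r// eq_sym; apply/negbTE.
(* A point is encoded by its Smith coordinates modulo the elementary divisors and by the floors of
   its coefficients, which lie in {-1, 0, 1} and are shifted by 1. Equal codes give coefficients
   that differ by integers of absolute value below 1, hence equal points. *)
pose F (i : 'I_k) : finType := ('I_`|(d`_i)%R| * 'I_3)%type.
have mlt (x : 'cV[int]_n) (i : 'I_k) : (`|(nz x i %% (d`_i)%R)%Z| < `|(d`_i)%R|)%N.
  have := modz_ge0 (nz x i) (dn0 i (ltn_ord i)).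
  by have := ltz_mod (nz x i) (dn0 i (ltn_ord i)); lia.
pose phi (x : 'cV[int]_n) : {dffun forall i, F i} :=
  [ffun i => (Ordinal (mlt x i), inord `|(Num.floor (c x i 0) + 1)%R|%N) : F i].
have phi_inj : {in s &, injective phi}.
  move=> x y xs ys exy.
  have h i : (nz x i %% (d`_i)%R)%Z = (nz y i %% (d`_i)%R)%Z /\
             Num.floor (c x i 0) = Num.floor (c y i 0).
    move: exy => /(congr1 (fun f : {dffun forall i, F i} => f i)).
    rewrite !ffunE => hp.
    have e1 := congr1 (fun p : F i => val p.1) hp.
    have e2 := congr1 (fun p : F i => val p.2) hp.
    move: e1 e2 => /= e1 e2.
    have := modz_ge0 (nz x i) (dn0 i (ltn_ord i)).
    have := modz_ge0 (nz y i) (dn0 i (ltn_ord i)).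
    have fl z : z \in s -> (-1 <= Num.floor (c z i 0) <= 1).
      move=> zs; have [_ /(_ i)] := hc _ zs; rewrite ler_norml => /andP[z1 z2].
      rewrite floor_ge_int; apply/andP; split => //.
      by rewrite -ltzD1 floor_lt_int; apply: le_lt_trans z2 _; rewrite ltr1n.
    have := fl _ xs; have := fl _ ys => fy fx.
    move: e2; rewrite !inordK; [lia|lia|lia].
  have cxy : c x = c y.
    pose q : 'cV[int]_k := \col_i ((nz x i - nz y i) %/ (d`_i)%R)%Z.
    have qE : toR q = toR R' *m (c x - c y).
      apply/matrixP => i j; rewrite ord1 [LHS]mxE [in LHS]mxE.
      have dn := dn0 i (ltn_ord i).
      have dnR : (d`_i)%:~R != 0 :> R by rewrite intr_eq0.
      apply: (mulfI dnR); rewrite -intrM.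
      have -> : d`_i * ((nz x i - nz y i) %/ (d`_i)%R)%Z = nz x i - nz y i.
        rewrite mulrC divzK// -eqz_mod_dvd.
        by apply/eqP; case: (h i).
      have subE (A B : 'cV[R]_k) : (A - B) i 0 = A i 0 - B i 0 by rewrite !mxE.
      by rewrite rmorphB/= !hnz// -mulrBr mulmxBr subE.
    have dE : c x - c y = toR (invmx R' *m q).
      rewrite map_mxM qE mulmxA -map_mxM mulVmx// map_mx1 mul1mx//.
    apply/eqP; rewrite -subr_eq0; apply/eqP/matrixP => i j; rewrite ord1 [RHS]mxE.
    have : (c x - c y) i 0 = ((invmx R' *m q) i 0)%:~R by rewrite dE mxE.
    have subE (A B : 'cV[R]_k) : (A - B) i 0 = A i 0 - B i 0 by rewrite !mxE.
    rewrite subE; move: ((invmx R' *m q) i 0) => zz hz.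
    have [_ hf] := h i.
    have := floor_itv (c x i 0); have := floor_itv (c y i 0).
    rewrite hf !intrD => /andP[a1 a2] /andP[a3 a4].
    have : `|zz%:~R| < 1 :> R by rewrite -hz ltr_norml; lra.
    rewrite -intr_norm ltrz1 => zlt; have z0 : zz = 0 by lia.
    by rewrite hz z0.
  have [ex _] := hc _ xs; have [ey _] := hc _ ys.
  apply/matrixP => i j; move: ex; rewrite cxy -ey => /matrixP /(_ i j).
  by rewrite !mxE => /intr_inj.
rewrite -(size_map phi).
have um : uniq (map phi s) by rewrite map_inj_in_uniq.
rewrite -(card_uniqP um); apply: leq_trans (max_card _) _.
rewrite card_dep_ffun foldrE big_image/= detU.
rewrite -[X in (X ^ k)%N]/3%N -[k in (3 ^ k)%N]card_ord -prod_nat_const -big_split/=.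
by apply: leq_prod => i _; rewrite card_prod !card_ord mulnC.
Qed.

(** Let [D] consist of the points of [s] selected by [max_gram_tuple]. Hadamard bounds
    [gram (G *m toR D)] by [r ^+ k], and this Gram determinant is that of [v] times the square of
    [\det U], the index that bounds [size s]. The 9 is the square of the 3 of [coset_count]. *)
Lemma lattice_points n (G : 'M[R]_n) (s : seq 'cV[int]_n) (r : R) :
  \det G != 0 -> uniq s -> 0 <= r ->
  (forall x, x \in s -> sqn (G *m toR x) <= r) ->
  exists k (v : 'M[int]_(n, k)),
  [/\ 0 < gram (G *m toR v),
      (size s)%:R ^+ 2 * gram (G *m toR v) <= 9 ^+ k * r ^+ k &
      forall x, x \in s -> exists c : 'cV[R]_k, toR x = toR v *m c].
Proof.
move=> dG us r0 hs.
have uG : G \in unitmx by rewrite unitmxE unitfE.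
pose y (i : 'I_(size s)) : 'cV[R]_n := G *m toR s`_i.
have [k [t [gd hd]]] := max_gram_tuple y.
pose D : 'M[int]_(n, k) := \matrix_(i, j) (s`_(t j)) i 0.
have dE : \matrix_(i, j) y (t j) i 0 = G *m toR D.
  apply/matrixP => i j; rewrite !mxE; apply: eq_bigr => l _.
  by rewrite !mxE.
have gD : gram (toR D) != 0.
  apply: contra gd; rewrite dE => /eqP /gram_eq0P [c c0 hc]; apply/eqP.
  apply/eqP; apply: contraT => g0; case/eqP: c0.
  apply: (gram_inj (X := G *m toR D)); rewrite ?mulmx0//.
  by rewrite -mulmxA hc mulmx0.
have hs' x : x \in s -> exists c : 'cV[R]_k,
     toR x = toR D *m c /\ forall i, `|c i 0| <= 1.
  move=> xs; have xi : (index x s < size s)%N by rewrite index_mem.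
  have [c [h1 h2]] := hd (Ordinal xi); exists c; split => //.
  move: h1; rewrite dE /y /= nth_index// -mulmxA => /(congr1 (mulmx (invmx G))).
  by rewrite !mulKmx.
have [v [U [DU sz]]] := coset_count gD us hs'.
have kn := gram_neq0_leq gd.
have gDU : gram (G *m toR D) = gram (G *m toR v) * (\det U)%:~R ^+ 2.
  by rewrite DU map_mxM mulmxA gramM det_map_mx.
exists k, v; split.
- rewrite lt_def gram_ge0// andbT; apply: contraNneq gd => g0.
  by rewrite dE gDU g0 mul0r.
- have szR : (size s)%:R ^+ 2 <= 9 ^+ k * (\det U)%:~R ^+ 2 :> R.
    have : (size s)%:R <= 3 ^+ k * `|(\det U)%:~R| :> R.
      move: sz; rewrite -(ler_nat R) natrM natrX => /le_trans; apply.
      by rewrite -intr_norm -abszE.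
    rewrite -(ler_pXn2r (n := 2)) ?nnegrE ?mulr_ge0 ?exprn_ge0// => /le_trans; apply.
    rewrite exprMn real_normK ?num_real// -exprM mulnC exprM.
    by rewrite (_ : 3 ^+ 2 = 9)// -natrX.
  apply: le_trans (ler_wpM2r (gram_ge0 _ kn) szR) _.
  rewrite -mulrA (mulrC (_ ^+ 2)) -gDU ler_wpM2l ?exprn_ge0//.
  apply: le_trans (hadamard _ kn) _.
  have -> : r ^+ k = \prod_(j < k) r by rewrite prodr_const card_ord.
  apply: ler_prod => j _; rewrite sqn_ge0 /= col_mulmx.
  have -> : col j (toR D) = toR s`_(t j) by apply/matrixP => a b; rewrite !mxE ord1.
  by apply: hs; rewrite mem_nth.
- move=> x /hs' [c [-> _]]; exists (toR U *m c).
  by rewrite DU map_mxM mulmxA.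
Qed.

(** Adding the standard basis vectors, which lie in the same ball by hypothesis, forces the rank in
    [lattice_points] to be [n]; then [v] is square with a nonzero integer determinant. *)
Lemma ball_count n (G : 'M[R]_n) (s : seq 'cV[int]_n) (r : R) :
  \det G != 0 -> uniq s -> 0 <= r ->
  (forall i, sqn (col i G) <= r) ->
  (forall x, x \in s -> sqn (G *m toR x) <= r) ->
  (size s)%:R ^+ 2 * \det G ^+ 2 <= 9 ^+ n * r ^+ n.
Proof.
move=> dG us r0 he hs.
pose e (i : 'I_n) : 'cV[int]_n := delta_mx i 0.
pose s' := undup (s ++ map e (enum 'I_n)).
have eE i : toR (e i) = delta_mx i 0 by rewrite /e map_delta_mx.
have hs' x : x \in s' -> sqn (G *m toR x) <= r.
  rewrite mem_undup mem_cat => /orP[/hs//|/mapP[i _ ->]].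
  by rewrite eE -colE.
have [k [v [gv sz sp]]] := lattice_points dG (undup_uniq _) r0 hs'.
have ss : (size s <= size s')%N.
  apply: uniq_leq_size => // x xs; by rewrite mem_undup mem_cat xs.
have kn : (k <= n)%N by apply: (@gram_neq0_leq _ _ (G *m toR v)); rewrite gt_eqF.
have /choice[C hC] : forall i, exists c : 'cV[R]_k, delta_mx i 0 = toR v *m c.
  move=> i; have [|c hc] := sp (e i).
    by rewrite mem_undup mem_cat map_f ?mem_enum ?orbT.
  by exists c; rewrite -eE.
have vC : toR v *m (\matrix_(a, b) C b a 0) = 1%:M.
  apply/matrixP => i j; have /matrixP/(_ i 0) := hC j.
  by rewrite !mxE eqxx andbT => ->; apply: eq_bigr => l _; rewrite !mxE.
have nk : (n <= k)%N.
  rewrite -(mxrank1 R n) -vC; apply: leq_trans (mxrankM_maxl _ _) _.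
  exact: rank_leq_col.
have E : k = n by apply/eqP; rewrite eqn_leq kn.
subst k.
have g1 : \det G ^+ 2 <= gram (G *m toR v).
  move: gv; rewrite gram_sq det_mulmx exprMn det_map_mx => gv.
  rewrite ler_peMr ?sqr_ge0// -rmorphXn /= ler1z.
  have : \det v != 0 by apply: contraTneq gv => ->; rewrite expr0n mulr0 ltxx.
  by move=> h; have : 0 < \det v ^+ 2 by rewrite exprn_even_gt0.
apply: le_trans sz; apply: ler_pM => //; rewrite ?sqr_ge0//.
by rewrite ler_pXn2r ?nnegrE// ler_nat.
Qed.

End LatticePoints.

(** * Reduced bases of lattices *)

Section Reduction.
Variable R : realType.
Local Notation toR := (map_mx (@intmul R 1)).

(** A crude bound for the square of the operator norm. It enters only thresholds, never the final
    constants. *)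
Definition opn n k (A : 'M[R]_(n, k)) : R := \sum_i (\sum_j `|A i j|) ^+ 2.

Lemma opn_ge0 n k (A : 'M[R]_(n, k)) : 0 <= opn A.
Proof. by apply: sumr_ge0 => i _; apply: sqr_ge0. Qed.

Lemma sqn_mulmx_le n k (A : 'M[R]_(n, k)) (x : 'cV[R]_k) :
  sqn (A *m x) <= opn A * sqn x.
Proof.
rewrite /opn mulr_suml; apply: ler_sum => i _.
rewrite -[sqn x]sqr_sqrtr ?sqn_ge0// -exprMn.
rewrite -[leLHS]real_normK ?num_real// ler_pXn2r ?nnegrE ?mulr_ge0 ?sumr_ge0 ?sqrtr_ge0//.
rewrite mxE mulr_suml; apply: le_trans (ler_norm_sum _ _ _) _.
apply: ler_sum => j _; rewrite normrM ler_wpM2l//.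
by rewrite -sqrtr_sqr ler_wsqrtr// entry_le_sqn.
Qed.

Lemma sqn_toR_ge1 n (x : 'cV[int]_n) : x != 0 -> 1 <= sqn (toR x).
Proof.
move=> x0; have [i xi] : exists i, x i 0 != 0.
  apply: contrapT => h; case/eqP: x0; apply/matrixP => i j; rewrite ord1 mxE.
  by apply/eqP; apply: contrapT => /negP xi; apply: h; exists i.
apply: le_trans (entry_le_sqn _ i); rewrite mxE -rmorphXn /= ler1z.
by have : 0 < x i 0 ^+ 2 by rewrite exprn_even_gt0.
Qed.

Lemma sqn_lattice_lb k (S : 'M[R]_k) : \det S != 0 ->
  exists2 a, 0 < a & forall n : 'cV[int]_k, n != 0 -> a <= sqn (S *m toR n).
Proof.
move=> dS; have uS : S \in unitmx by rewrite unitmxE unitfE.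
exists (1 + opn (invmx S))^-1; first by rewrite invr_gt0 ltr_wpDr// opn_ge0.
move=> n n0.
have h1 := sqn_toR_ge1 n0.
have h2 := sqn_mulmx_le (invmx S) (S *m toR n).
rewrite mulKmx// in h2.
have o0 := opn_ge0 (invmx S); have s0 := sqn_ge0 (S *m toR n).
have p : 0 < 1 + opn (invmx S) by lra.
rewrite -(ler_pM2l p) mulfV ?gt_eqF//; nra.
Qed.

(** A vector whose squared length is within a factor 5/4 of the infimum is enough, so the infimum
    need not be shown to be attained. *)
Lemma short_vector k (S : 'M[R]_k.+1) : \det S != 0 ->
  exists2 n : 'cV[int]_k.+1, n != 0 &
  forall m : 'cV[int]_k.+1, m != 0 -> 4 / 5 * sqn (S *m toR n) <= sqn (S *m toR m).
Proof.
move=> dS; have [a a0 ha] := sqn_lattice_lb dS.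
pose E := [set x | exists2 n : 'cV[int]_k.+1, n != 0 & x = sqn (S *m toR n)].
have lbE : lbound E a by move=> x [n n0 ->]; apply: ha.
have hE : has_inf E.
  split; last by exists a.
  exists (sqn (S *m toR (delta_mx 0 0))), (delta_mx 0 0) => //.
  by apply/eqP => /matrixP /(_ 0 0); rewrite !mxE !eqxx.
have i0 : a <= inf E by apply: lb_le_inf => //; case: hE.
have [|x [n n0 ->] hx] := @inf_adherent _ E (inf E / 4) _ hE; first lra.
exists n => // m m0.
have : inf E <= sqn (S *m toR m).
  by apply: ge_inf; [case: hE | exists m].
by lra.
Qed.

(** The Smith form writes a short vector as an integer multiple of the first column of a unimodular
    matrix; this column is no longer than the vector. *)
Lemma short_primitive k (S : 'M[R]_k.+1) : \det S != 0 ->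
  exists2 L : 'M[int]_k.+1, L \in unitmx &
  forall m : 'cV[int]_k.+1, m != 0 ->
    4 / 5 * sqn (S *m toR (col 0 L)) <= sqn (S *m toR m).
Proof.
move=> dS; have [n n0 hn] := short_vector dS.
have [L uL [R' uR [d _ nE]]] := int_Smith_normal_form n.
exists L => // m m0; apply: le_trans (hn m m0).
apply: ler_wpM2l; first by lra.
pose z := d`_0 * R' 0 0.
have nz : n = z *: col 0 L.
  rewrite nE; apply/matrixP => i j; rewrite ord1 !mxE big_ord1 !mxE.
  rewrite big_ord_recl big1 ?addr0; last first.
    by move=> l _; rewrite !mxE /= mulr0n mulr0.
  by rewrite !mxE /= mulr1n /z -mulrA mulrC.
have z0 : z != 0 by apply: contraNneq n0 => h; rewrite nz h scale0r.
have -> : toR n = z%:~R *: toR (col 0 L).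
  by rewrite nz; apply/matrixP => i j; rewrite !mxE intrM.
rewrite -scalemxAr sqnZ ler_peMl ?sqn_ge0// -rmorphXn /= ler1z.
by have : 0 < z ^+ 2 by rewrite exprn_even_gt0.
Qed.

Lemma unitmx_int_det k (U : 'M[int]_k) : U \in unitmx -> `|\det (toR U)| = 1.
Proof.
rewrite det_map_mx unitmxE qualifE/= => /orP[]/eqP->; rewrite ?rmorphN ?normrN.
  by rewrite normr1.
by rewrite normr1.
Qed.

Lemma orth_det k (Q : 'M[R]_k) : Q^T *m Q = 1%:M -> `|\det Q| = 1.
Proof.
move=> /(congr1 determinant); rewrite det_mulmx det_tr det1 -expr2 => h.
by apply/eqP; rewrite -(@eqrXn2 _ 2)// real_normK ?num_real// h expr1n.
Qed.

(** The [b i] are the Gram-Schmidt lengths of the basis [S *m toR U]. A short primitive vector is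
    rotated onto the first axis, the projected lattice [S'] is reduced by induction, and its basis
    is lifted with rounding. *)
Lemma reduced_basis k (S : 'M[R]_k) : \det S != 0 ->
  exists (U : 'M[int]_k) (b : 'I_k -> R),
  [/\ U \in unitmx, forall i, 0 < b i,
      forall i j : 'I_k, j = i.+1 :> nat -> b i <= 2 * b j,
      \prod_i b i = `|\det S| &
      forall j, sqn (S *m toR (col j U)) <= \sum_(i < k | (i <= j)%N) b i ^+ 2].
Proof.
elim: k S => [|k IH] S dS.
  exists 1%:M, (fun=> 1); split => //; rewrite ?unitmx1//.
  - by case.
  - by rewrite big_ord0 det_mx00 normr1.
  - by case.
have [L uL hL] := short_primitive dS.
have [H [r [S' [HH HE]]]] := @householder_block R k k (S *m toR L).
set b := Num.sqrt _ in HE.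
have colS : col 0 (S *m toR L) = S *m toR (col 0 L).
  by rewrite col_mulmx map_col.
have b2 : b ^+ 2 = sqn (S *m toR (col 0 L)) by rewrite sqr_sqrtr ?sqn_ge0// colS.
have detE : `|\det S| = b * `|\det S'|.
  have := congr1 determinant HE; rewrite det_ublock det_scalar1 !det_mulmx.
  move=> /(congr1 Num.norm); rewrite !normrM (orth_det HH) mul1r.
  have l1 := unitmx_int_det uL; set y := (X in _ * X = _).
  have -> : y = 1 := l1.
  by rewrite mulr1 => ->; rewrite ger0_norm ?sqrtr_ge0.
have b0 : 0 < b.
  rewrite lt_def sqrtr_ge0 andbT; apply: contraNneq dS => h.
  by rewrite -normr_eq0 detE h mul0r.
have dS' : \det S' != 0.
  by apply: contraNneq dS => h; rewrite -normr_eq0 detE h normr0 mulr0.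
have [U' [b' [uU' b'0 b'2 b'p b's]]] := IH S' dS'.
pose t : 'rV[R]_k := r *m toR U'.
(* Rounding to the nearest multiple of [b] makes the first coordinate of each lifted vector at most
   [b / 2] in absolute value. *)
pose m : 'rV[int]_k := \row_j (- Num.floor (t 0 j / b + 2^-1)).
have mt j : (b * (m 0 j)%:~R + t 0 j) ^+ 2 <= b ^+ 2 / 4.
  rewrite mxE rmorphN /=.
  have /andP[] := floor_itv (t 0 j / b + 2^-1); set f := Num.floor _.
  rewrite intrD => h1 h2.
  have tE : t 0 j = b * (t 0 j / b) by field; rewrite gt_eqF.
  rewrite tE; move: (t 0 j / b) h1 h2 => u h1 h2.
  have -> : b * - f%:~R + b * u = b * (u - f%:~R) by ring.
  by rewrite exprMn; apply: ler_wpM2l; [nra | nra].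
clearbody m.
pose V : 'M[int]_(1 + k) := block_mx 1%:M m 0 U'.
have col0 : S *m toR (col 0 (L *m V)) = S *m toR (col 0 L).
  rewrite col_mulmx; congr (_ *m toR _).
  rewrite [RHS]colE; congr (_ *m _); apply/matrixP => i j; rewrite ord1 !mxE.
  case: splitP => i1 hi1; rewrite !mxE; case: splitP => j1 hj1; rewrite ?mxE//.
  - by rewrite !ord1 (_ : i = 0) ?eqxx//; apply: val_inj; rewrite /= hi1 ord1.
  - by rewrite (_ : (i == 0) = false)//; apply/negbTE/eqP => i0; rewrite i0 in hi1.
have colj (j : 'I_k) : sqn (S *m toR (col (rshift 1 j) (L *m V))) =
    (b * (m 0 j)%:~R + t 0 j) ^+ 2 + sqn (S' *m toR (col j U')).
  rewrite col_mulmx map_mxM mulmxA -(sqn_orth _ HH) mulmxA HE.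
  have -> : toR (col (rshift 1 j) V) = col_mx (m 0 j)%:~R%:M (toR (col j U')).
    rewrite /V; apply/matrixP => i l; rewrite ord1 !mxE.
    case: splitP => i1 hi1; rewrite !mxE; case: splitP => j1 hj1; rewrite ?mxE//.
    + by move: (ltn_ord j1); rewrite -hj1.
    + rewrite !ord1 eqxx mulr1n; congr (m _ _)%:~R; apply: val_inj.
      by move: hj1 => /= /addnI.
    + by move: (ltn_ord j1); rewrite -hj1.
    + congr (U' _ _)%:~R; apply: val_inj; by move: hj1 => /= /addnI.
  have E : (block_mx b%:M r 0 S' : 'M[R]_(1 + k)) *m
      col_mx ((m 0 j)%:~R%:M : 'M[R]_1) (toR (col j U')) =
      col_mx (b * (m 0 j)%:~R + t 0 j)%:M (S' *m toR (col j U')).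
    rewrite mul_block_col mul0mx add0r -scalar_mxM.
    have -> : r *m toR (col j U') = (t 0 j)%:M.
      rewrite /t; apply/matrixP => p q; rewrite !ord1 !mxE mulr1n.
      by apply: eq_bigr => l _; rewrite !mxE.
    by rewrite -raddfD.
  transitivity (sqn (col_mx (b * (m 0 j)%:~R + t 0 j)%:M (S' *m toR (col j U')))).
    by congr sqn; exact: E.
  rewrite {1}/sqn big_split_ord/= big_ord1 col_mxEu mxE mulr1n.
  by congr (_ + _); apply: eq_bigr => i _; rewrite col_mxEd.
pose bb (i : 'I_(1 + k)) := match fintype.split i with inl _ => b | inr j => b' j end.
have bb0 : bb 0 = b by rewrite /bb; case: splitP => // j /=.
have bbr j : bb (rshift 1 j) = b' j.
  by rewrite /bb; have := @unsplitK 1 k (inr j); rewrite /= => ->.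
have uV : V \in unitmx by rewrite unitmxE /V det_ublock det1 mul1r -unitmxE.
have uU : L *m V \in unitmx by rewrite unitmx_mul uL.
exists (L *m V), bb; split => //.
- by move=> i; rewrite /bb; case: fintype.split.
- move=> i j ij; case: (@split_ordP 1 k j) ij => [j1 -> | j1 -> ij]; first by rewrite /= ord1.
  rewrite bbr; case: (@split_ordP 1 k i) ij => i1 -> /= ij; last first.
    by rewrite bbr; apply: b'2; lia.
  have j10 : j1 = 0%N :> nat by move: ij; rewrite ord1 /=; lia.
  have -> : lshift k i1 = 0 by apply: val_inj; rewrite /= ord1.
  rewrite bb0.
  have := b's j1; rewrite (bigD1 j1)//= big1 ?addr0; last first.
    move=> l /andP[lj ll]; exfalso; move/eqP: ll; apply; apply: val_inj; move: lj; rewrite /= j10; lia.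
  move=> hb'.
  (* The second basis vector is nonzero, so its squared length is at least 4/5 of [b ^+ 2]; it is
     also at most [b ^+ 2 / 4 + b' j1 ^+ 2]. Together these give more than [b <= 2 * b' j1]. *)
  have ncol : col (rshift 1 j1) (L *m V) != 0.
    apply/eqP => h; have := colj j1; rewrite h raddf0 mulmx0.
    have -> : sqn (0 : 'cV[R]_k.+1) = 0 by apply/eqP; rewrite sqn_eq0.
    have := sqr_ge0 (b * (m 0 j1)%:~R + t 0 j1).
    have s1 := sqn_ge0 (S' *m toR (col j1 U')) => s2 s3.
    have /eqP : sqn (S' *m toR (col j1 U')) = 0 by lra.
    have uS' : S' \in unitmx by rewrite unitmxE unitfE.
    rewrite sqn_eq0 => /eqP /(congr1 (mulmx (invmx S'))); rewrite mulKmx// mulmx0 => /matrixP h0.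
    have : col j1 U' = 0.
      apply/matrixP => p q; have := h0 p q; rewrite !mxE => /eqP; rewrite intr_eq0 => /eqP//.
    move=> hc; move: uU'; rewrite unitmxE; have : \det U' = 0.
      rewrite (expand_det_col _ j1) big1// => p _.
      by have /matrixP/(_ p 0) := hc; rewrite !mxE => ->; rewrite mul0r.
    by move=> ->; rewrite unitr0.
  have := hL _ ncol; rewrite colj -b2 => h1; have := mt j1 => h2.
  rewrite -(ler_pXn2r (n := 2)) ?nnegrE ?mulr_ge0 ?(ltW b0) ?(ltW (b'0 _))// exprMn.
  have := sqr_ge0 b; lra.
- by rewrite (@big_split_ord _ _ _ 1 k)/= big_ord1 detE -b'p; congr (_ * _);
    [rewrite -bb0; congr bb; apply: val_inj | apply: eq_bigr => i _; rewrite bbr].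
- move=> j; rewrite big_mkcond (@big_split_ord _ _ _ 1 k)/= big_ord1.
  have -> : lshift k (0 : 'I_1) = 0 by apply: val_inj.
  rewrite bb0 /=; case: (@split_ordP 1 k j) => j1 ->.
    have -> : lshift k j1 = 0 by apply: val_inj; rewrite /= ord1.
    by rewrite col0 -b2 big1 ?addr0.
  rewrite colj; apply: lerD.
    by have := mt j1; have := sqr_ge0 b; lra.
  apply: le_trans (b's j1) _; rewrite big_mkcond; apply: ler_sum => i _.
  by rewrite bbr.
Qed.

End Reduction.

(** * Counting sublattices up to change of basis *)

Section ClassCount.
Variable R : realType.
Local Notation toR := (map_mx (@intmul R 1)).

Lemma reduced_basis_mx n k (X : 'M[R]_(n, k)) : gram X != 0 ->
  exists (U : 'M[int]_k) (b : 'I_k -> R),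
  [/\ U \in unitmx, forall i, 0 < b i,
      forall i j : 'I_k, j = i.+1 :> nat -> b i <= 2 * b j,
      (\prod_i b i) ^+ 2 = gram X &
      forall j, sqn (X *m toR (col j U)) <= \sum_(i < k | (i <= j)%N) b i ^+ 2].
Proof.
move=> gX; have kn := gram_neq0_leq gX.
have En : n = (k + (n - k))%N by lia.
move: (n - k)%N En => m En; subst n.
have [Q [S [QQ QX _]]] := qr X.
have gS : gram X = \det S ^+ 2 by rewrite -(gram_orth X QQ) QX gram_col_mx0.
have dS : \det S != 0 by apply: contraNneq gX => h; rewrite gS h expr0n.
have [U [b [h1 h2 h3 h4 h5]]] := reduced_basis dS.
exists U, b; split => //; first by rewrite h4 real_normK ?num_real.
move=> j; rewrite -(sqn_orth _ QQ) mulmxA QX mul_col_mx mul0mx.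
rewrite /sqn big_split_ord/= [X in _ + X]big1 ?addr0; last first.
  by move=> i _; rewrite col_mxEd mxE expr0n.
apply: le_trans (h5 j); rewrite /sqn; apply: ler_sum => i _.
by rewrite col_mxEu.
Qed.

Lemma dyadic_floor (a b : R) : 0 < a -> a <= b ->
  exists e : nat, a * 2 ^+ e <= b /\ b < a * 2 ^+ e.+1.
Proof.
move=> a0 ab.
have ex : exists e, b < a * 2 ^+ e.+1.
  exists (Num.bound (b / a)); rewrite mulrC -ltr_pdivrMr//.
  have /archi_boundP : 0 <= b / a by apply: divr_ge0; [apply: le_trans ab|]; apply: ltW.
  move=> /lt_le_trans; apply; rewrite -natrX ler_nat.
  by rewrite (leq_trans (ltnW (ltn_expl _ (ltnSn 1))))// leq_exp2l.
case: (ex_minnP ex) => e he hmin; exists e; split => //.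
case: e he hmin => [|e] he hmin; first by rewrite expr0 mulr1.
by rewrite leNgt; apply/negP => /hmin; rewrite ltnn.
Qed.

(** The profile [e] records the dyadic sizes of the Gram-Schmidt lengths in units of [a]. These
    lengths drop by at most a factor 2 at each step and the first is at least [a0], so all are at
    least [a0 / 2 ^+ k]. In the bound on the columns, 2 comes from dyadic rounding, [2 ^+ k] from
    comparing [b i] with [b j], and [k.+1] covers the number of summands. *)
Lemma reduced_profile n k (G : 'M[R]_n) (a0 : R) (v : 'M[int]_(n, k.+1)) :
  0 < a0 -> gram (G *m toR v) != 0 ->
  (forall m : 'cV[int]_k.+1, m != 0 -> a0 ^+ 2 <= sqn (G *m toR (v *m m))) ->
  let a := a0 / 2 ^+ k in
  exists (U : 'M[int]_k.+1) (e : 'I_k.+1 -> nat),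
  [/\ U \in unitmx,
      forall j, sqn (G *m toR (col j (v *m U))) <= (2 * (k.+1)%:R * 2 ^+ k * a * 2 ^+ e j) ^+ 2,
      forall j, (e ord0 <= e j + k.+1)%N &
      (a ^+ k.+1 * 2 ^+ (\sum_j e j)%N) ^+ 2 <= gram (G *m toR v)].
Proof.
move=> a00 gv sv a.
have [U [b [uU b0 b2 bp bs]]] := reduced_basis_mx gv.
have a_gt0 : 0 < a by rewrite divr_gt0// exprn_gt0.
have a_ge0 := ltW a_gt0; have a0_ge0 := ltW a00.
have b_ge0 j : 0 <= b j by apply: ltW.
have bij (d : nat) (i j : 'I_k.+1) : (j = i + d :> nat)%N -> b i <= 2 ^+ d * b j.
  elim: d j => [|d IH] j ij.
    by rewrite expr0 mul1r (_ : i = j)//; apply: val_inj; rewrite /= ij addn0.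
  have jk : (i + d < k.+1)%N by have := ltn_ord j; lia.
  apply: le_trans (IH (Ordinal jk) _) _ => //.
  rewrite exprSr -mulrA ler_wpM2l ?exprn_ge0//; apply: b2; rewrite /=; lia.
have bij' (i j : 'I_k.+1) : (i <= j)%N -> b i <= 2 ^+ k * b j.
  move=> ij; apply: le_trans (bij (j - i)%N i j _) _; first by lia.
  rewrite ler_wpM2r ?b_ge0// ler_weXn2l ?ler1n//; have := ltn_ord j; lia.
have colj j : G *m toR v *m toR (col j U) = G *m toR (col j (v *m U)).
  by rewrite -mulmxA -map_mxM col_mulmx.
have Un0 j : col j U != 0.
  apply/eqP => hc; move: uU; rewrite unitmxE; have -> : \det U = 0.
    rewrite (expand_det_col _ j) big1// => p _.
    by have /matrixP/(_ p 0) := hc; rewrite !mxE => ->; rewrite mul0r.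
  by rewrite unitr0.
have b00 : a0 <= b ord0.
  rewrite -(ler_pXn2r (n := 2)) ?nnegrE ?b_ge0//.
  have := bs ord0; rewrite (bigD1 ord0)//= big1 ?addr0; last first.
    move=> l /andP[lj ll]; exfalso; move/eqP: ll; apply; apply: val_inj.
    by move: lj; rewrite /=; lia.
  apply: le_trans; rewrite -mulmxA -map_mxM; apply: sv; exact: Un0.
have ab j : a <= b j.
  rewrite ler_pdivrMr ?exprn_gt0// mulrC; apply: le_trans b00 _; exact: bij'.
clearbody a.
have /choice[e he] : forall j, exists e : nat, a * 2 ^+ e <= b j /\ b j < a * 2 ^+ e.+1.
  by move=> j; apply: dyadic_floor.
exists U, e; split => //.
- move=> j; rewrite -colj; apply: le_trans (bs j) _.
  have H (i : 'I_k.+1) : (i <= j)%N -> b i ^+ 2 <= (2 * 2 ^+ k * a * 2 ^+ e j) ^+ 2.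
    move=> ij; rewrite ler_pXn2r ?nnegrE ?mulr_ge0 ?exprn_ge0 ?b_ge0//.
    apply: le_trans (bij' _ _ ij) _.
    have [_ /ltW h] := he j; apply: le_trans (ler_wpM2l _ h) _; first exact: exprn_ge0.
    by rewrite exprS le_eqVlt; apply/orP; left; apply/eqP; ring.
  set z := (2 * 2 ^+ k * a * 2 ^+ e j) ^+ 2 in H.
  apply: (@le_trans _ _ (\sum_(i < k.+1) z)).
    rewrite big_mkcond; apply: ler_sum => i _; case: ifP => [/H//|_]; exact: sqr_ge0.
  rewrite sumr_const card_ord.
  have -> : (2 * (k.+1)%:R * 2 ^+ k * a * 2 ^+ e j) ^+ 2 = (k.+1)%:R ^+ 2 * z.
    by rewrite /z; ring.
  rewrite -[z *+ _]mulr_natl ler_wpM2r ?sqr_ge0// expr2 ler_peMl ?ler1n//.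
- move=> j; have [h1 _] := he ord0; have [_ h2] := he j.
  rewrite leqNgt; apply/negP => lt.
  have : a * 2 ^+ e ord0 < a * 2 ^+ (e j + k.+1).
    apply: le_lt_trans h1 _; apply: le_lt_trans (bij' ord0 j _) _ => //.
    rewrite addnS -addSn exprD mulrA mulrC ltr_pM2r ?exprn_gt0//.
  by rewrite ltr_pM2l// ltr_eXn2l ?ltr1n//; lia.
- rewrite -bp ler_pXn2r ?nnegrE ?mulr_ge0 ?exprn_ge0 ?prodr_ge0//.
  rewrite -prodrXr -[in X in X * _](card_ord k.+1) -prodr_const -big_split/=.
  apply: ler_prod => j _; rewrite mulr_ge0 ?exprn_ge0 ?b_ge0//=.
  by case: (he j).
Qed.

Lemma size_le_prod_cols n k (t : seq 'M[int]_(n, k)) : uniq t ->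
  (size t <= \prod_j size (undup [seq col j w | w <- t]))%N.
Proof.
move=> ut.
case: t ut => [|w0 t0] ut //.
set t := w0 :: t0 in ut *.
pose L j := undup [seq col j w | w <- t].
have L0 j : (0 < size (L j))%N.
  rewrite -has_predT; apply/hasP; exists (col j w0) => //.
  by rewrite mem_undup map_f// mem_head.
have ilt j w : w \in t -> (index (col j w) (L j) < size (L j))%N.
  by move=> wt; rewrite index_mem mem_undup map_f.
pose phi (w : 'M[int]_(n, k)) : {dffun forall j, 'I_(size (L j))} :=
  [ffun j => insubd (Ordinal (L0 j)) (index (col j w) (L j)) : 'I_(size (L j))].
have inj : {in t &, injective phi}.
  move=> w w' wt wt' e; apply/matrixP => i j.
  have : col j w = col j w'.
    move: e => /(congr1 (fun f : {dffun forall j, 'I_(size (L j))} => val (f j))).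
    rewrite !ffunE /= !val_insubd !ilt// => e.
    rewrite -(nth_index 0 (_ : col j w \in L j)); last by rewrite mem_undup map_f.
    by rewrite e nth_index// mem_undup map_f.
  by move=> /matrixP /(_ i 0); rewrite !mxE.
rewrite -(size_map phi).
have um : uniq (map phi t) by rewrite map_inj_in_uniq.
rewrite -(card_uniqP um); apply: leq_trans (max_card _) _.
rewrite card_dep_ffun foldrE big_image/=.
by apply: leq_prod => i _; rewrite card_ord.
Qed.

(** Matrices of full column rank are equivalent exactly when their columns generate the same
    lattice, so sublattices are counted as lists of pairwise inequivalent matrices. *)
Definition equivZ n k (v v' : 'M[int]_(n, k)) : Prop :=
  exists2 U : 'M[int]_k, U \in unitmx & v' = v *m U.

Lemma sqnD_le n (x y : 'cV[R]_n) : sqn (x + y) <= 2 * sqn x + 2 * sqn y.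
Proof.
rewrite /sqn !mulr_sumr -big_split/=; apply: ler_sum => i _; rewrite !mxE.
have := sqr_ge0 (x i 0 - y i 0); nra.
Qed.

(* A class with profile [e] has [\prod_j 2 ^ (e j - e 0)] reduced bases, obtained by
   adding small multiples of the first vector to the others, all made of short vectors. *)
Lemma profile_count n k (G : 'M[R]_n) (a C1 : R) (e : 'I_k.+1 -> nat)
    (s : seq 'M[int]_(n, k.+1)) (f : 'M[int]_(n, k.+1) -> 'M[int]_k.+1) :
  0 < a -> uniq s ->
  (forall v v', v \in s -> v' \in s -> equivZ v v' -> v = v') ->
  (forall v, v \in s -> gram (toR v) != 0) ->
  (forall v, v \in s -> f v \in unitmx) ->
  (forall v j, v \in s -> sqn (G *m toR (col j (v *m f v))) <= (a * 2 ^+ e j) ^+ 2) ->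
  (forall j (t : seq 'cV[int]_n), uniq t ->
     (forall x, x \in t -> sqn (G *m toR x) <= (2 * a * 2 ^+ e j) ^+ 2) ->
     (size t)%:R <= C1 * (2 * a * 2 ^+ e j) ^+ n) ->
  (size s * \prod_j 2 ^ (e j - e ord0))%:R <=
    \prod_j (C1 * (2 * a * 2 ^+ e j) ^+ n).
Proof.
move=> a0 us ineq gs uf hf hball.
pose F := {dffun forall j : 'I_k.+1, 'I_(2 ^ (e j - e ord0))}.
(* The first row of [T m] carries the multiples. The entry [m ord0] ranges below 2^0, so it is 0 and
   [T m] is unipotent. *)
pose T (m : F) : 'M[int]_k.+1 :=
  \matrix_(i, j) ((i == j)%:R + (i == ord0)%:R * (m j : nat)%:Z).
have m0 (m : F) : (m ord0 : nat) = 0%N.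
  apply/eqP; rewrite -leqn0 -ltnS; apply: leq_trans (ltn_ord _) _.
  by rewrite subnn.
have uT m : T m \in unitmx.
  rewrite unitmxE -det_tr det_trig; last first.
    apply/is_trig_mxP => i j ij; rewrite !mxE.
    have -> : (j == i) = false by apply/negbTE/eqP => E; rewrite E ltnn in ij.
    have -> : (j == ord0) = false by apply/negbTE/eqP => E; rewrite E in ij.
    by rewrite mul0r addr0.
  rewrite big1 ?unitr1// => i _; rewrite !mxE eqxx.
  by case: (i =P ord0) => [->|_]; rewrite ?m0 ?mulr0 ?mul0r addr0.
pose t := [seq v *m f v *m T m | v <- s, m <- enum {: F}].
have ut : uniq t.
  apply: allpairs_uniq => //; first exact: enum_uniq.
  move=> [v m] [v' m'] /=.
  move=> /allpairsP[[v1 m1] /= [v1s _ [-> ->]]] /allpairsP[[v2 m2] /= [v2s _ [-> ->]]].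
  move=> E.
  (* Equal products make [v1] and [v2] equivalent, hence equal; independence of the columns then
     recovers [T m], and its first row recovers [m]. *)
  have vv : v1 = v2.
    apply: ineq => //; exists (f v1 *m T m1 *m invmx (f v2 *m T m2)).
      by rewrite !unitmx_mul unitmx_inv unitmx_mul !uT !uf.
    by rewrite !mulmxA E -[X in X *m _]mulmxA mulmxK// unitmx_mul uf ?uT.
  subst v2; congr (_, _).
  have TT : T m1 = T m2.
    have gv : gram (toR (v1 *m f v1)) != 0.
      rewrite map_mxM gramM mulf_neq0 ?gs// sqrf_eq0 -normr_eq0 unitmx_int_det ?oner_eq0//.
      exact: uf.
    have : toR (T m1) = toR (T m2).
      by apply: (gram_inj gv); rewrite -!map_mxM E.
    move=> /matrixP h; apply/matrixP => i j; have := h i j; rewrite !mxE.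
    by move=> /intr_inj.
  apply/ffunP => j; apply: val_inj; move: TT => /matrixP /(_ ord0 j).
  by rewrite !mxE eqxx !mul1r => /addrI [].
have st : size t = (size s * \prod_j 2 ^ (e j - e ord0))%N.
  rewrite size_allpairs; congr (_ * _)%N.
  rewrite -cardE card_dep_ffun foldrE big_image/=.
  by apply: eq_bigr => i _; rewrite card_ord.
rewrite -st; apply: (@le_trans _ _ (\prod_j size (undup [seq col j w | w <- t]))%N%:R).
  by rewrite ler_nat; apply: size_le_prod_cols.
rewrite natr_prod; apply: ler_prod => j _; rewrite ler0n /=.
apply: hball; first exact: undup_uniq.
move=> x; rewrite mem_undup => /mapP[w /allpairsP[[v m] /= [vs _ ->]] ->].
have -> : col j (v *m f v *m T m) =
    col j (v *m f v) + (if j == ord0 then 0 else (m j : nat)%:Z) *: col ord0 (v *m f v).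
  move: (v *m f v) => z.
  rewrite col_mulmx; apply/matrixP => p q; rewrite ord1 [LHS]mxE.
  rewrite (eq_bigr (fun l => z p l * (l == j)%:R +
     z p l * ((l == ord0)%:R * (m j : nat)%:Z))); last first.
    by move=> l _; rewrite !mxE mulrDr.
  rewrite big_split/= (bigD1 j)//= eqxx mulr1 big1 ?addr0; last first.
    by move=> l /negbTE ->; rewrite mulr0.
  rewrite (bigD1 ord0)//= ?eqxx mul1r big1 ?addr0; last first.
    by move=> l /negbTE ->; rewrite mul0r mulr0.
  rewrite !mxE mulrC; congr (_ + _ * _).
  by case: (j =P ord0) => [->|//]; rewrite m0.
have -> : toR (col j (v *m f v) + (if j == ord0 then 0 else (m j : nat)%:Z) *: col ord0 (v *m f v)) =
   toR (col j (v *m f v)) + (if j == ord0 then 0 else (m j : nat)%:R) *: toR (col ord0 (v *m f v)).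
  apply/matrixP => p q; rewrite !mxE intrD intrM; congr (_ + _ * _).
  by case: ifP.
rewrite mulmxDr -scalemxAr; apply: le_trans (sqnD_le _ _) _.
have h1 := hf v j vs; have h2 := hf v ord0 vs.
have h3 : sqn ((if j == ord0 then 0 else (m j : nat)%:R) *: (G *m toR (col ord0 (v *m f v)))) <=
    (a * 2 ^+ e j) ^+ 2.
  rewrite sqnZ; case: (j =P ord0) => [_|_]; first by rewrite expr0n mul0r sqr_ge0.
  (* If [e j < e ord0], the subtraction truncates to 0 and the only multiple is 0; otherwise the
     multiple is below the ratio of the two size bounds. *)
  have [le|gt] := leqP (e ord0) (e j).
    apply: (@le_trans _ _ ((2 ^+ (e j - e ord0)) ^+ 2 * (a * 2 ^+ e ord0) ^+ 2)).
      apply: ler_pM => //; rewrite ?sqr_ge0 ?sqn_ge0// ler_pXn2r ?nnegrE ?exprn_ge0//.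
      by rewrite -natrX ler_nat ltnW.
    rewrite -exprMn le_eqVlt; apply/orP; left; apply/eqP; congr (_ ^+ 2).
    by rewrite mulrCA -exprD subnK.
  have -> : (m j : nat) = 0%N.
    apply/eqP; rewrite -leqn0 -ltnS; apply: leq_trans (ltn_ord _) _.
    by rewrite (_ : e j - e ord0 = 0)%N//; lia.
  by rewrite expr0n mul0r sqr_ge0.
apply: (@le_trans _ _ (4 * (a * 2 ^+ e j) ^+ 2)); first by lra.
by rewrite le_eqVlt; apply/orP; left; apply/eqP; ring.
Qed.

End ClassCount.

(** * Summation of the class counts over all profiles *)

Section ClassCountTotal.
Variable R : realType.
Local Notation toR := (map_mx (@intmul R 1)).

Lemma gram_mulmx_neq0 n m k (G : 'M[R]_(m, n)) (X : 'M[R]_(n, k)) :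
  gram (G *m X) != 0 -> gram X != 0.
Proof.
move=> gGX; apply: contraT; rewrite negbK => /eqP /gram_eq0P [c c0 hc].
case/eqP: c0; apply: (gram_inj gGX).
by rewrite -mulmxA hc !mulmx0.
Qed.

Lemma size_sum_count (I : finType) (T : Type) (g : T -> I) (s : seq T) :
  size s = (\sum_i count (fun v => g v == i) s)%N.
Proof.
elim: s => [|v s IH] /=; first by rewrite big1.
rewrite big_split/= -IH (bigD1 (g v))//= eqxx big1// => i iv.
by rewrite eq_sym (negbTE iv).
Qed.

Lemma sum_half_le2 M : \sum_(i < M) (2^-1 : R) ^+ i <= 2.
Proof.
suff -> : \sum_(i < M) (2^-1 : R) ^+ i = 2 - 2 * 2^-1 ^+ M.
  by rewrite lerBlDr lerDl mulr_ge0// exprn_ge0// invr_ge0.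
elim: M => [|M IH]; first by rewrite big_ord0 expr0; lra.
by rewrite big_ord_recr/= IH exprS; lra.
Qed.

Lemma sum_dyadic_le n M (x Y : R) : (0 < n)%N -> 0 < x -> 0 <= Y ->
  \sum_(i < M | x * 2 ^+ i <= Y) (x * 2 ^+ i) ^+ n <= 2 * Y ^+ n.
Proof.
move=> n0 x0 Y0.
have full m : \sum_(i < m.+1) (x * 2 ^+ i) ^+ n <= 2 * (x * 2 ^+ m) ^+ n.
  elim: m => [|m IH].
    rewrite big_ord1 expr0 mulr1.
    by have := exprn_ge0 n (ltW x0); lra.
  rewrite big_ord_recr/=.
  have : 2 * (x * 2 ^+ m) ^+ n <= (x * 2 ^+ m.+1) ^+ n.
    rewrite exprS mulrCA [leRHS]exprMn ler_wpM2r ?exprn_ge0 ?mulr_ge0 ?(ltW x0) ?exprn_ge0//.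
    by rewrite -[leLHS]expr1 ler_weXn2l// ler1n.
  by move: IH; lra.
elim: M => [|M IH].
  by rewrite big_ord0 mulr_ge0 ?exprn_ge0.
have [le|gt] := leP (x * 2 ^+ M) Y.
  apply: (@le_trans _ _ (2 * (x * 2 ^+ M) ^+ n)).
    apply: le_trans (full M); rewrite big_mkcond; apply: ler_sum => i _.
    by case: ifP => // _; rewrite exprn_ge0// mulr_ge0 ?exprn_ge0// ltW.
  by rewrite ler_wpM2l// ler_pXn2r// nnegrE mulr_ge0 ?exprn_ge0 ?(ltW x0).
rewrite big_mkcond big_ord_recr /= ifF; last by apply/negbTE; rewrite -ltNge.
by rewrite addr0 -big_mkcond.
Qed.

(** For a profile [e] with sum [i], the ball counts allow at most a constant times
    [(a ^+ K * 2 ^+ i) ^+ n] matrices, and [profile_count] divides this by the number of bases per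
    class, comparable to the product of the [2 ^+ h j]. Summing over the shifts [h] gives convergent
    geometric series, and summing over [i] a geometric series dominated by its largest term, at most
    [Y ^+ n]. The constant does not depend on [G] or [a0]. *)
Lemma class_count n k (C1 : R) : (0 < n)%N -> 0 < C1 ->
  exists2 C : R, 0 < C &
  forall (G : 'M[R]_n) (a0 : R), 0 < a0 ->
  (forall (a : R) (t : seq 'cV[int]_n), a0 <= a -> uniq t ->
     (forall x, x \in t -> sqn (G *m toR x) <= a ^+ 2) ->
     (size t)%:R <= C1 * a ^+ n) ->
  forall (Y : R) (s : seq 'M[int]_(n, k.+1)), 0 < Y -> uniq s ->
  (forall v v', v \in s -> v' \in s -> equivZ v v' -> v = v') ->
  (forall v, v \in s -> gram (G *m toR v) != 0) ->
  (forall v, v \in s -> gram (G *m toR v) <= Y ^+ 2) ->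
  (forall v (m : 'cV[int]_k.+1), v \in s -> m != 0 ->
     a0 ^+ 2 <= sqn (G *m toR (v *m m))) ->
  (size s)%:R <= C * Y ^+ n.
Proof.
move=> n0 C10.
pose K := k.+1.
pose Cc : R := C1 ^+ K * (4 * K%:R * 2 ^+ k) ^+ (n * K) * 2 ^+ (K * K).
have Cc0 : 0 < Cc by rewrite !mulr_gt0 ?exprn_gt0 ?mulr_gt0 ?exprn_gt0 ?ltr0n.
exists (Cc * 2 * 2 ^+ K); first by apply: mulr_gt0; [exact: mulr_gt0|rewrite exprn_gt0].
move=> G a0 a00 ball Y s Y0 us ineq gs gY short.
pose a := a0 / 2 ^+ k.
have a_gt0 : 0 < a by rewrite divr_gt0// exprn_gt0.
have /choice[U hU] : forall v, exists U : 'M[int]_K, v \in s ->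
  exists e : 'I_K -> nat,
  [/\ U \in unitmx,
      forall j, sqn (G *m toR (col j (v *m U))) <= (2 * K%:R * 2 ^+ k * a * 2 ^+ e j) ^+ 2,
      forall j, (e ord0 <= e j + K)%N &
      (a ^+ K * 2 ^+ (\sum_j e j)%N) ^+ 2 <= gram (G *m toR v)].
  move=> v; have [vs|vs] := boolP (v \in s); last by exists 0.
  have [||U [e h]] := @reduced_profile _ _ _ G a0 v a00; first exact: gs.
    by move=> m m0; apply: short.
  by exists U; exists e.
have /choice[e he] : forall v, exists e : 'I_K -> nat, v \in s ->
  [/\ U v \in unitmx,
      forall j, sqn (G *m toR (col j (v *m U v))) <= (2 * K%:R * 2 ^+ k * a * 2 ^+ e j) ^+ 2,
      forall j, (e ord0 <= e j + K)%N &
      (a ^+ K * 2 ^+ (\sum_j e j)%N) ^+ 2 <= gram (G *m toR v)].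
  move=> v; have [vs|vs] := boolP (v \in s); last by exists (fun=> 0%N).
  by have [e h] := hU v vs; exists e.
pose sg v := (\sum_j e v j)%N.
(* The shift by [K] makes the subtraction exact, because [e v ord0 <= e v j + K]. *)
pose h v j := (e v j + K - e v ord0)%N.
pose M := (\max_(v <- s) (sg v + K))%N.
have sgM v : v \in s -> (sg v + K <= M)%N.
  by move=> vs; rewrite /M (big_rem v vs)/= leq_maxl.
have hM v j : v \in s -> (h v j <= M)%N.
  move=> vs; apply: leq_trans (sgM v vs); rewrite /h /sg (bigD1 j)//=; lia.
pose g v : 'I_M.+1 * {ffun 'I_K -> 'I_M.+1} := (inord (sg v), [ffun j => inord (h v j)]).
have aK2 (i : nat) : 0 <= a ^+ K * 2 ^+ i by rewrite mulr_ge0 ?exprn_ge0// ltW.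
have group (i : 'I_M.+1) (F : {ffun 'I_K -> 'I_M.+1}) :
  (count (fun v => g v == (i, F)) s)%:R <=
   if a ^+ K * 2 ^+ i <= Y then Cc * (a ^+ K * 2 ^+ i) ^+ n * \prod_j (2^-1) ^+ (F j) else 0.
  rewrite -size_filter; set s' := [seq v <- s | _].
  have hs' v : v \in s' -> [/\ v \in s, sg v = i & forall j, h v j = F j].
    rewrite mem_filter => /andP[/eqP [/(congr1 val) e1 /ffunP e2] vs]; split => //.
      by move: e1; rewrite /= inordK// ltnS; have := sgM v vs; lia.
    move=> j; have := e2 j; rewrite ffunE => /(congr1 val).
    by rewrite /= inordK// ltnS hM.
  have [s0|] := eqVneq s' [::].
    rewrite s0 /=; case: ifP => // _.
    apply: mulr_ge0; last by apply: prodr_ge0 => j _; rewrite exprn_ge0// invr_ge0.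
    by apply: mulr_ge0; [exact: ltW | rewrite exprn_ge0].
  have us' : uniq s' by apply: filter_uniq.
  case: s' hs' us' => // v0 s0; set s' := v0 :: s0 => hs' us' _.
  have [v0s sg0 h0] := hs' v0 (mem_head _ _).
  have [_ _ e0 g0] := he v0 v0s.
  have iY : a ^+ K * 2 ^+ i <= Y.
    rewrite -(ler_pXn2r (n := 2)) ?nnegrE ?aK2 ?(ltW Y0)//.
    apply: le_trans (gY v0 v0s); rewrite -sg0; exact: g0.
  rewrite iY.
  (* The sum [i] and the shifts determine the profile: adding the shifts gives
     [i + K * K - K * e v ord0], which yields [e v ord0] and then every [e v j]. *)
  have ev v : v \in s' -> forall j, e v j = e v0 j.
    move=> vs'; have [vs sgv hv] := hs' v vs'; have [_ _ ev _] := he v vs.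
    have key w (ew : forall j, (e w ord0 <= e w j + K)%N) :
        (sg w + K * K = \sum_j h w j + K * e w ord0)%N.
      have cst c : (K * c = \sum_(j < K) c)%N by rewrite sum_nat_const card_ord.
      rewrite /sg (cst K) (cst (e w ord0)) -!big_split/=.
      by apply: eq_bigr => j _; rewrite /h subnK.
    have k1 := key v ev; have k2 := key v0 e0.
    have hh : (\sum_j h v j = \sum_j h v0 j)%N by apply: eq_bigr => j _; rewrite hv h0.
    have eq0 : e v ord0 = e v0 ord0.
      apply/eqP; rewrite -(@eqn_pmul2l K)//; apply/eqP/(@addnI (\sum_j h v j)).
      by rewrite -k1 sgv hh -k2 sg0.
    move=> j; have := hv j; rewrite -h0 /h; move: (ev j) (e0 j); rewrite eq0.
    by move: (e v j) (e v0 j) (e v0 ord0) => x y w; clear; lia.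
  have := @profile_count R n k G (2 * K%:R * 2 ^+ k * a) C1 (e v0) s' U.
  set z := 2 * K%:R * 2 ^+ k * a.
  have z0 : 0 < z by apply: mulr_gt0 => //; rewrite !mulr_gt0 ?exprn_gt0 ?ltr0n.
  move=> /(_ z0 us') pc.
  have {}pc : (size s' * \prod_j 2 ^ (e v0 j - e v0 ord0))%:R <=
    \prod_j (C1 * (2 * z * 2 ^+ e v0 j) ^+ n).
    apply: pc.
    - move=> v v' /hs'[vs _ _] /hs'[v's _ _]; exact: ineq.
    - move=> v /hs'[vs _ _]; apply: (@gram_mulmx_neq0 _ _ _ G); exact: gs.
    - by move=> v /hs'[vs _ _]; have [] := he v vs.
    - move=> v j vs'; rewrite -(ev v vs'); have [vs _ _] := hs' v vs'.
      by have [_ /(_ j)] := he v vs.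
    - move=> j t ut ht; apply: ball => //.
      (* The ball count is available only for radii at least [a0]; this form shows that the radius
         qualifies. *)
      have -> : 2 * z * 2 ^+ e v0 j = a0 * (4 * K%:R * 2 ^+ e v0 j).
        have aE : 2 ^+ k * a = a0 by rewrite /a mulrC divfK// expf_neq0// pnatr_eq0.
        by rewrite /z -aE; ring.
      rewrite ler_peMr ?(ltW a00)// -[leLHS]mulr1 ler_pM//.
        rewrite -[leLHS]mulr1 ler_pM// ?ler1n//; lra.
      by rewrite exprn_ege1// ler1n.
  have szh : (size s')%:R * \prod_j 2 ^+ (F j) <=
     2 ^+ (K * K) * (size s' * \prod_j 2 ^ (e v0 j - e v0 ord0))%:R :> R.
    rewrite natrM mulrCA ler_wpM2l// natr_prod.
    have -> : 2 ^+ (K * K) = \prod_(j < K) (2 ^+ K : R).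
      by rewrite prodr_const card_ord exprM.
    rewrite -big_split/=; apply: ler_prod => j _; rewrite exprn_ge0//=.
    rewrite -h0 /h natrX -exprD ler_weXn2l// ?ler1n//.
    by move: (e v0 j) (e v0 ord0) => x y; clear; lia.
  have pE : \prod_j (C1 * (2 * z * 2 ^+ e v0 j) ^+ n) =
     C1 ^+ K * (4 * K%:R * 2 ^+ k) ^+ (n * K) * (a ^+ K * 2 ^+ i) ^+ n.
    rewrite big_split/= prodr_const card_ord -mulrA; congr (_ * _).
    rewrite -sg0 /sg prodrXl big_split/= prodr_const card_ord prodrXr.
    rewrite [(n * K)%N]mulnC exprM -exprMn; congr (_ ^+ n).
    by rewrite [RHS]mulrA -exprMn; congr (_ ^+ _ * _); rewrite /z; ring.
  have p0 : 0 < \prod_j (2 : R) ^+ (F j) by apply: prodr_gt0 => j _; rewrite exprn_gt0.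
  have -> : \prod_j (2^-1 : R) ^+ (F j) = (\prod_j (2 : R) ^+ (F j))^-1.
    by rewrite -prodfV; apply: eq_bigr => j _; rewrite exprVn.
  rewrite ler_pdivlMr//; apply: le_trans szh _.
  rewrite pE in pc; apply: le_trans (ler_wpM2l _ pc) _; first by rewrite exprn_ge0.
  by rewrite le_eqVlt; apply/orP; left; apply/eqP; rewrite /Cc; ring.
rewrite (size_sum_count g) natr_sum -(pair_big xpredT xpredT
  (fun i F => (count (fun v => g v == (i, F)) s)%:R))/=.
apply: (@le_trans _ _ (\sum_(i < M.+1) \sum_(F : {ffun 'I_K -> 'I_M.+1})
   (if a ^+ K * 2 ^+ i <= Y then Cc * (a ^+ K * 2 ^+ i) ^+ n * \prod_j (2^-1) ^+ (F j) else 0))).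
  by apply: ler_sum => i _; apply: ler_sum => F _; apply: group.
apply: (@le_trans _ _ (\sum_(i < M.+1 | a ^+ K * 2 ^+ i <= Y) Cc * (a ^+ K * 2 ^+ i) ^+ n * 2 ^+ K)).
  rewrite [leRHS]big_mkcond; apply: ler_sum => i _.
  case: ifP => _; last by rewrite big1.
  rewrite -mulr_sumr -(bigA_distr_bigA (fun (j : 'I_K) (l : 'I_M.+1) => (2^-1 : R) ^+ l)).
  apply: ler_wpM2l; first by apply: mulr_ge0; [exact: ltW|rewrite exprn_ge0].
  have -> : (2 : R) ^+ K = \prod_(j < K) 2 by rewrite prodr_const card_ord.
  apply: ler_prod => j _; rewrite sum_half_le2 andbT.
  by apply: sumr_ge0 => l _; rewrite exprn_ge0// invr_ge0.
have -> : Cc * 2 * 2 ^+ K * Y ^+ n = Cc * 2 ^+ K * (2 * Y ^+ n) by ring.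
rewrite (eq_bigr (fun i : 'I_M.+1 => Cc * 2 ^+ K * (a ^+ K * 2 ^+ i) ^+ n)); last first.
  by move=> i _; ring.
rewrite -mulr_sumr.
apply: ler_wpM2l; first by apply: mulr_ge0; [exact: ltW|rewrite exprn_ge0].
by apply: sum_dyadic_le => //; [rewrite exprn_gt0|exact: ltW].
Qed.

End ClassCountTotal.

(** * Many inequivalent sublattices *)

Section Family.
Variable R : realType.
Local Notation toR := (map_mx (@intmul R 1)).

(** There are [q ^ (n * k)] choices of [f], and the covolume is of order at most [q ^ k]; this gives
    the order X^n at X of order [q ^ k]. The entries [4 * k * q] outweigh the sum of the [k]
    perturbations in their row. *)
Definition dominant_mx n k q (f : {ffun 'I_n * 'I_k -> 'I_q}) : 'M[int]_(n, k) :=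
  \matrix_(i, j) (((i == j :> nat) * (4 * k * q) + f (i, j))%N%:Z).

(** Take [j] with the largest coefficient and look at row [j]: the dominant entry contributes 4kq
    times this coefficient, the others at most kq times it. *)
Lemma dominant_mx_lb n k q (f : {ffun 'I_n * 'I_k -> 'I_q}) (c : 'cV[R]_k) :
  (k <= n)%N -> c != 0 -> exists (i : 'I_n) (j : 'I_k), c j 0 != 0 /\
    (3 * k * q)%:R * `|c j 0| <= `|(toR (dominant_mx f) *m c) i 0|.
Proof.
move=> kn c0.
have [j1 cj1] : exists i, c i 0 != 0.
  apply: contrapT => h; case/eqP: c0; apply/matrixP => i j; rewrite ord1 mxE.
  by apply/eqP; apply: contrapT => /negP xi; apply: h; exists i.
pose j := [arg max_(i > j1) `|c i 0|]%O.
have jmax l : `|c l 0| <= `|c j 0|.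
  by rewrite /j; case: arg_maxP => //= i _ h; apply: h.
exists (widen_ord kn j), j; split.
  by rewrite -normr_gt0; apply: lt_le_trans (jmax j1); rewrite normr_gt0.
have -> : (toR (dominant_mx f) *m c) (widen_ord kn j) 0 =
    (4 * k * q)%:R * c j 0 + \sum_l (f (widen_ord kn j, l))%:R * c l 0.
  rewrite mxE (eq_bigr (fun l => (j == l)%:R * (4 * k * q)%:R * c l 0 +
    (f (widen_ord kn j, l))%:R * c l 0)); last first.
    by move=> l _; rewrite !mxE /= -pmulrn natrD natrM mulrDl.
  rewrite big_split/=; congr (_ + _); rewrite (bigD1 j)//= eqxx mul1r big1 ?addr0//.
  by move=> l lj; rewrite eq_sym (negbTE lj) !mul0r.
have h1 : `|\sum_l (f (widen_ord kn j, l))%:R * c l 0| <= (k * q)%:R * `|c j 0|.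
  apply: le_trans (ler_norm_sum _ _ _) _.
  apply: (@le_trans _ _ (\sum_(l < k) q%:R * `|c j 0|)).
    apply: ler_sum => l _; rewrite normrM normr_nat ler_pM// ler_nat ltnW//.
  by rewrite sumr_const card_ord -[_ * _ *+ _]mulr_natl mulrA natrM.
apply: le_trans (lerB_normD _ _); rewrite normrM normr_nat.
move: h1; rewrite !natrM; set x := \sum_l _; move: `|x| `|c j 0| => y z.
by move: (k%:R) (q%:R) => a b; nra.
Qed.

(** If [U] is not the identity, a nonzero integer column of [U - 1%:M] is sent by [dominant_mx f] to
    a vector with an entry of size at least 3kq; but this vector is a column of the difference of
    the two matrices, with entries below q. *)
Lemma dominant_inequiv n k q (f f' : {ffun 'I_n * 'I_k -> 'I_q}) : (k <= n)%N ->
  equivZ (dominant_mx f) (dominant_mx f') -> f = f'.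
Proof.
move=> kn [U _ E].
have U1 : U = 1%:M.
  apply/eqP; rewrite -subr_eq0; apply/negPn/negP => U1.
  have [j cj] : exists j, col j (U - 1%:M) != 0.
    apply: contrapT => h; case/eqP: U1; apply/matrixP => i j; rewrite [RHS]mxE.
    have : col j (U - 1%:M) = 0 by apply/eqP; apply: contrapT => /negP xi; apply: h; exists j.
    by move=> /matrixP /(_ i 0); rewrite [LHS]mxE [RHS]mxE.
  have cj' : toR (col j (U - 1%:M)) != 0.
    apply: contraNneq cj => /matrixP h; apply/eqP/matrixP => a b; have := h a b.
    by rewrite [LHS]mxE !(mxE _ _ a b) => /eqP; rewrite intr_eq0 => /eqP.
  have [i [l [cl]]] := dominant_mx_lb f kn cj'.
  have c1 : 1 <= `|toR (col j (U - 1%:M)) l 0|.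
    move: cl; rewrite [toR _ l 0]mxE intr_eq0 => cl.
    by rewrite -intr_norm ler1z; lia.
  rewrite -map_mxM -col_mulmx mulmxBr mulmx1 -E.
  have -> : toR (col j (dominant_mx f' - dominant_mx f)) i 0 =
     ((f' (i, j) : nat)%:Z - (f (i, j) : nat)%:Z)%:~R.
    rewrite !mxE; congr (_%:~R); lia.
  move=> h; have : (3 * k * q)%:R <= `|((f' (i, j) : nat)%:Z - (f (i, j) : nat)%:Z)%:~R| :> R.
    by apply: le_trans h; rewrite ler_peMr.
  rewrite -intr_norm -[X in X <= _ -> _]/(((3 * k * q)%N%:Z)%:~R) ler_int.
  have := ltn_ord (f (i, j)); have := ltn_ord (f' (i, j)); have := ltn_ord l.
  move: (nat_of_ord (f (i, j))) (nat_of_ord (f' (i, j))) => a b; clear; nia.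
move: E; rewrite U1 mulmx1 => /matrixP h; apply/ffunP => -[i j]; apply: val_inj.
by have := h i j; rewrite !mxE => -[] /addnI.
Qed.

Lemma gram_dominant n k q (f : {ffun 'I_n * 'I_k -> 'I_q}) : (0 < k <= n)%N ->
  gram (toR (dominant_mx f)) <= ((5 * k * n * q)%:R ^+ k) ^+ 2.
Proof.
move=> /andP[k0 kn]; apply: le_trans (hadamard _ kn) _.
have -> : ((5 * k * n * q)%:R ^+ k) ^+ 2 = \prod_(j < k) (5 * k * n * q)%:R ^+ 2 :> R.
  by rewrite prodr_const card_ord -!exprM [(k * 2)%N]mulnC.
apply: ler_prod => j _; rewrite sqn_ge0 /=.
apply: (@le_trans _ _ (\sum_(i < n) (5 * k * q)%:R ^+ 2)).
  apply: ler_sum => i _; rewrite !mxE -pmulrn ler_pXn2r ?nnegrE// ler_nat.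
  have := ltn_ord (f (i, j)); case: (_ == _); move: (nat_of_ord (f _)) => a;
  move: k0; clear; nia.
rewrite sumr_const card_ord -[_ ^+ 2 *+ n]mulr_natl.
have -> : (5 * k * n * q)%:R ^+ 2 = n%:R ^+ 2 * (5 * k * q)%:R ^+ 2 :> R.
  by rewrite !natrM; ring.
by rewrite ler_wpM2r ?sqr_ge0// -natrX ler_nat; move: k0 kn; clear; nia.
Qed.

(** Take the largest [q] with [(D * q)%:R ^+ k <= X]. The order of quantifiers matters: [M] affects
    only the threshold [X0], not [c]. *)
Lemma lower_count n k : (0 < k <= n)%N -> exists2 c : R, 0 < c &
  forall M : R, exists X0 : R, forall X, X0 <= X ->
  exists s : seq 'M[int]_(n, k),
  [/\ uniq s, c * X ^+ n <= (size s)%:R,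
      forall v v', v \in s -> v' \in s -> equivZ v v' -> v = v',
      forall v, v \in s -> gram (toR v) != 0 /\ gram (toR v) <= X ^+ 2 &
      forall v (m : 'cV[int]_k), v \in s -> m != 0 -> M ^+ 2 <= sqn (toR (v *m m))].
Proof.
move=> kn; have /andP[k0 kn'] := kn.
pose D := (5 * k * n)%N.
have D0 : (0 < D)%N by rewrite /D; move: k0 kn'; clear; nia.
have c0 : 0 < ((2 * D)%:R ^+ (k * n) : R) by rewrite exprn_gt0// ltr0n; lia.
exists ((2 * D)%:R ^+ (k * n))^-1; first by rewrite invr_gt0.
(* [q >= q0] puts [3 * k * q] above the absolute value of [M]; [q >= 1] gives [q.+1 <= 2 * q], the
   origin of the factor 2 in [c]. *)
move=> M; pose q0 := (Num.bound `|M|).+1.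
exists ((D * q0)%:R ^+ k) => X X0.
pose P q := (D * q)%:R ^+ k <= X.
have exP : exists q, P q by exists q0.
have X_ge0 : 0 <= X by apply: le_trans X0; rewrite exprn_ge0.
have Pb q : P q -> (q <= Num.bound X)%N.
  move=> Pq; rewrite ltnW// -(ltr_nat R); apply: le_lt_trans (archi_boundP X_ge0).
  apply: le_trans Pq; rewrite -natrX ler_nat.
  case: q => [|q] //; rewrite -{1}(expn1 q.+1) (leq_trans (leq_pexp2l _ k0))// leq_exp2r//.
  by move: D0; clear; nia.
case: (ex_maxnP exP Pb) => q Pq qmax.
have q0q : (q0 <= q)%N by apply: qmax.
pose s := [seq dominant_mx f | f <- enum {: {ffun 'I_n * 'I_k -> 'I_q}}].
have inj : injective (fun f : {ffun 'I_n * 'I_k -> 'I_q} => dominant_mx f).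
  move=> f f' E; apply: (dominant_inequiv kn'); exists 1%:M; rewrite ?unitmx1//.
  by rewrite mulmx1.
exists s; split.
- by rewrite map_inj_uniq ?enum_uniq.
- rewrite size_map -cardE card_ffun card_prod !card_ord.
  rewrite ler_pdivrMl//.
  have : ~~ P q.+1 by apply/negP => /qmax; rewrite ltnn.
  rewrite -ltNge => XD.
  apply: (@le_trans _ _ (((D * q.+1)%:R ^+ k) ^+ n)).
    by apply: lerXn2r; rewrite ?nnegrE ?exprn_ge0//; exact: ltW.
  rewrite -exprM natrX [(n * k)%N]mulnC -exprMn.
  apply: lerXn2r; rewrite ?nnegrE ?mulr_ge0//.
  rewrite -natrM ler_nat; move: q0q; rewrite /q0; clear; nia.
- move=> v v' /mapP[f _ ->] /mapP[f' _ ->] E.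
  by rewrite (dominant_inequiv kn' E).
- move=> v /mapP[f _ ->]; split.
    apply/eqP => /gram_eq0P [c cn0 hc].
    have [i [j [cj]]] := dominant_mx_lb f kn' cn0.
    rewrite hc mxE normr0 leNgt mulr_gt0 ?normr_gt0// ltr0n.
    by move: q0q k0; rewrite /q0; clear; nia.
  apply: le_trans (gram_dominant _ kn) _.
  by rewrite ler_pXn2r ?nnegrE ?exprn_ge0.
- move=> v m /mapP[f _ ->] m0.
  have m0' : toR m != 0.
    apply: contraNneq m0 => /matrixP h; apply/eqP/matrixP => a b; have := h a b.
    by rewrite !mxE => /eqP; rewrite intr_eq0 => /eqP.
  have [i [j [mj hij]]] := dominant_mx_lb f kn' m0'.
  rewrite map_mxM; apply: le_trans (entry_le_sqn _ i).
  rewrite -[leLHS]real_normK ?num_real// -[leRHS]real_normK ?num_real//.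
  rewrite ler_pXn2r ?nnegrE//; apply: le_trans hij.
  have c1 : 1 <= `|toR m j 0|.
    by move: mj; rewrite mxE intr_eq0 => cl; rewrite -intr_norm ler1z; lia.
  apply: (@le_trans _ _ (3 * k * q)%:R); last by rewrite ler_peMr.
  have := archi_boundP (normr_ge0 M) => /ltW /le_trans; apply.
  rewrite ler_nat; move: q0q k0; rewrite /q0; move: (Num.bound _) => b; clear.
  by case: k => // k; nia.
Qed.

End Family.

(** * Haar measure *)

Section Haar.
Variable R : realType.

(** In the frame of [qr], [X] is an orthonormal family times [S]. Hadamard applies to the images
    under [M] of this family, each of squared length at most [opn M]. *)
Lemma gram_mulmx_le n m k (M : 'M[R]_(m, n)) (X : 'M[R]_(n, k)) :
  (k <= n)%N -> (k <= m)%N -> gram (M *m X) <= opn M ^+ k * gram X.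
Proof.
move=> kn km; have En : n = (k + (n - k))%N by lia.
move: (n - k)%N En => l En; subst n.
have [Q [S [QQ QX _]]] := qr X.
have gX : gram X = \det S ^+ 2 by rewrite -(gram_orth X QQ) QX gram_col_mx0.
have QQ' : Q *m Q^T = 1%:M by apply: mulmx1C.
pose E : 'M[R]_(k + l, k) := col_mx 1%:M 0.
have ES : col_mx S 0 = E *m S by rewrite /E mul_col_mx mul1mx mul0mx.
have XE : X = Q^T *m E *m S by rewrite -mulmxA -ES -QX mulmxA QQ mul1mx.
rewrite gX {1}XE !mulmxA gramM ler_wpM2r ?sqr_ge0//.
apply: le_trans (hadamard _ km) _.
have -> : opn M ^+ k = \prod_(j < k) opn M by rewrite prodr_const card_ord.
apply: ler_prod => j _; rewrite sqn_ge0 /= -!mulmxA col_mulmx.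
apply: le_trans (sqn_mulmx_le _ _) _.
rewrite -[leRHS]mulr1 ler_wpM2l ?opn_ge0// col_mulmx sqn_orth ?trmxK//.
rewrite /sqn big_split_ord/= [X in _ + X]big1 ?addr0; last first.
  by move=> i _; rewrite mxE col_mxEd mxE expr0n.
rewrite (bigD1 j)//= big1 ?addr0; last first.
  by move=> i ij; rewrite mxE col_mxEu mxE (negbTE ij) expr0n.
by rewrite mxE col_mxEu mxE eqxx expr1n.
Qed.

(** The matrix of [qr] may have determinant -1. It is corrected by changing the sign of one of the
    last [m.+1] coordinates, where the image of [v] vanishes; this needs rank less than the
    dimension. *)
Lemma SO_frame k m (v : 'M[R]_(k + m.+1, k)) :
  exists (h : 'M[R]_(k + m.+1)) (S : 'M[R]_k),
    [/\ SOset h, h *m v = col_mx S 0 & gram v = \det S ^+ 2].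
Proof.
have [Q [S [QQ QX _]]] := qr v.
have gX : gram v = \det S ^+ 2 by rewrite -(gram_orth v QQ) QX gram_col_mx0.
have QQ' : Q *m Q^T = 1%:M by apply: mulmx1C.
have := orth_det QQ; have [d0|d0] := leP 0 (\det Q).
  by rewrite ger0_norm// => d1; exists Q, S.
rewrite ltr0_norm// => d1.
pose F : 'M[R]_m.+1 := diag_mx (\row_i if i == 0 then -1 else 1).
have FF : F *m F^T = 1%:M.
  rewrite tr_diag_mx mulmx_diag; apply/matrixP => i j; rewrite !mxE.
  by case: (_ =P 0) => _; rewrite ?mulrNN mulr1 ?mulr1n.
have dF : \det F = -1.
  rewrite det_diag (bigD1 0)//= mxE eqxx big1 ?mulr1// => i i0.
  by rewrite mxE (negbTE i0).
pose D : 'M[R]_(k + m.+1) := block_mx 1%:M 0 0 F.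
exists (D *m Q), S; split => //.
- split.
    rewrite trmx_mul mulmxA -(mulmxA D) QQ' mulmx1 tr_block_mx mulmx_block.
    by rewrite !trmx0 trmx1 !mulmx0 !mul0mx !mul1mx FF !addr0 !add0r -scalar_mx_block.
  by rewrite det_mulmx det_ublock det1 mul1r dF mulN1r.
- by rewrite -mulmxA QX mul_block_col !mul0mx !mulmx0 mul1mx !addr0.
Qed.

(** * Measurability of Gram determinants of random matrices *)

Section Measurability.
Variables (d : measure_display) (T : measurableType d).

Lemma measurable_mulmx n m k (A : T -> 'M[R]_(n, m)) (B : T -> 'M[R]_(m, k)) :
  (forall i j, measurable_fun setT (fun w => A w i j)) ->
  (forall i j, measurable_fun setT (fun w => B w i j)) ->
  forall i j, measurable_fun setT (fun w => (A w *m B w) i j).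
Proof.
move=> mA mB i j.
have -> : (fun w => (A w *m B w) i j) = (fun w => \sum_l A w i l * B w l j).
  by apply/funext => w; rewrite mxE.
apply: measurable_sum => l; exact: measurable_funM.
Qed.

Lemma measurable_det k (A : T -> 'M[R]_k) :
  (forall i j, measurable_fun setT (fun w => A w i j)) ->
  measurable_fun setT (fun w => \det (A w)).
Proof.
move=> mA; rewrite /determinant; apply: measurable_sum => s.
apply: measurable_funM; first exact: measurable_cst.
by apply: measurable_prod => i _.
Qed.

Lemma measurable_gram n k (A : T -> 'M[R]_(n, k)) :
  (forall i j, measurable_fun setT (fun w => A w i j)) ->
  measurable_fun setT (fun w => gram (A w)).
Proof.
move=> mA; apply: measurable_det; apply: measurable_mulmx => // i j.
have -> : (fun w => (A w)^T i j) = (fun w => A w j i).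
  by apply/funext => w; rewrite mxE.
exact: mA.
Qed.

Lemma measurable_gram_rot N k (W : 'M[R]_N) (v : 'M[R]_(N, k)) (M : T -> 'M[R]_N) :
  (forall i j, measurable_fun setT (fun w => M w i j)) ->
  measurable_fun setT (fun w => gram (W *m (M w)^T *m v)).
Proof.
move=> mM; apply: measurable_gram.
apply: (measurable_mulmx (A := fun w => W *m (M w)^T) (B := fun=> v)); last first.
  by move=> i j; exact: measurable_cst.
apply: (measurable_mulmx (A := fun=> W) (B := fun w => (M w)^T)).
  by move=> i j; exact: measurable_cst.
move=> i j; have -> : (fun w => (M w)^T i j) = (fun w => M w j i).
  by apply/funext => w; rewrite mxE.
exact: mM.
Qed.

Lemma measurable_le_cst (f : T -> R) (y : R) :
  measurable_fun setT f -> measurable [set w | f w <= y].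
Proof.
move=> mf; have := mf measurableT _ (measurable_itv `]-oo, y]).
rewrite setTI; congr (measurable _); apply/seteqP; split => w /=;
by rewrite in_itv.
Qed.

End Measurability.

(** The sets on which [haar_SO] asserts invariance. They form a pi-system, which is what the
    extension in [haar_law] rests on. *)
Definition rects N : set (set 'M[R]_N) := [set A | exists B : 'I_N -> 'I_N -> set R,
  (forall i j, measurable (B i j)) /\ A = [set M : 'M[R]_N | forall i j, B i j (M i j)]].

Lemma rects_setI N : setI_closed (@rects N).
Proof.
move=> _ _ [B [mB ->]] [B' [mB' ->]].
exists (fun i j => B i j `&` B' i j); split; first by move=> i j; exact: measurableI.
apply/seteqP; split => M /=; first by move=> [h1 h2] i j; split.
by move=> h; split => i j; have [] := h i j.
Qed.

Lemma measurable_rect d (T : measurableType d) N (M : T -> 'M[R]_N)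
    (B : 'I_N -> 'I_N -> set R) :
  (forall i j, measurable_fun setT (fun w => M w i j)) ->
  (forall i j, measurable (B i j)) ->
  measurable [set w | forall i j, B i j (M w i j)].
Proof.
move=> mM mB.
have -> : [set w | forall i j, B i j (M w i j)] =
    \bigcap_(p in [set: 'I_N * 'I_N]) ((fun w => M w p.1 p.2) @^-1` B p.1 p.2).
  apply/seteqP; split => w /=; first by move=> h [i j] _; exact: h.
  by move=> h i j; exact: (h (i, j)).
apply: fin_bigcap_measurable; first exact: finite_finset.
by move=> p _; rewrite -[X in measurable X]setTI; apply: mM.
Qed.

(** Dynkin's pi-lambda argument: the sets on which the two laws agree, with measurable preimages,
    form a lambda-system containing [rects]. *)
Lemma haar_law (d : measure_display) (Omega : measurableType d)
    (P : probability Omega R) N (g : Omega -> 'M[R]_N) (h : 'M[R]_N) :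
  haar_SO P g -> SOset h -> forall A, <<s @rects N >> A ->
  [/\ measurable (g @^-1` A), measurable ((fun w => h *m g w) @^-1` A) &
      P (g @^-1` A) = P ((fun w => h *m g w) @^-1` A)].
Proof.
move=> [gSO mg inv] hSO.
have mhg i j : measurable_fun setT (fun w => (h *m g w) i j).
  apply: (measurable_mulmx (A := fun=> h)) => // a b; exact: measurable_cst.
pose K := [set A : set 'M[R]_N | [/\ measurable (g @^-1` A),
  measurable ((fun w => h *m g w) @^-1` A) &
  P (g @^-1` A) = P ((fun w => h *m g w) @^-1` A)]].
suff : <<s @rects N >> `<=` K by [].
rewrite -setI_closed_g_dynkin_g_sigma_algebra; last exact: rects_setI.
apply: smallest_sub; last first.
  move=> _ [B [mB ->]]; split.
  - exact: measurable_rect.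
  - exact: (measurable_rect (M := fun w => h *m g w)).
  - exact: inv.
split.
- by split; rewrite !preimage_setT.
- move=> A [m1 m2 e].
  have C (f : Omega -> 'M[R]_N) : f @^-1` (~` A) = ~` (f @^-1` A) by [].
  split; [rewrite C; exact: measurableC..|].
  rewrite (C g) (C (fun w => h *m g w)) (probability_setC P m1).
  by rewrite (probability_setC P m2) e.
- move=> F tF KF; split.
  + by rewrite preimage_bigcup; apply: bigcup_measurable => n _; have [] := KF n.
  + by rewrite preimage_bigcup; apply: bigcup_measurable => n _; have [] := KF n.
  + have triv (f : Omega -> 'M[R]_N) : trivIset setT (fun n => f @^-1` F n).
      apply/trivIsetP => i j _ _ ij; rewrite -preimage_setI.
      by move/trivIsetP : tF => ->//; rewrite preimage_set0.
    rewrite !preimage_bigcup !measure_bigcup//.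
    * by apply: eq_eseriesr => n _; have [] := KF n.
    * by move=> n _; have [] := KF n.
    * by move=> n _; have [] := KF n.
Qed.

(** The rotation [h] of [SO_frame] takes the span of [v] to a coordinate subspace, and
    [(g w)^T *m h^T] is the transpose of [h *m g w], which has the law of [g w]. Only [gram v]
    remains of [v]. *)
Lemma haar_gram (d : measure_display) (Omega : measurableType d)
    (P : probability Omega R) k m (g : Omega -> 'M[R]_(k + m.+1))
    (W : 'M[R]_(k + m.+1)) (v : 'M[R]_(k + m.+1, k)) (y : R) :
  haar_SO P g ->
  P [set w | gram (W *m (g w)^T *m v) <= y] =
  P [set w | gram (W *m (g w)^T *m col_mx 1%:M 0) * gram v <= y].
Proof.
move=> hg; have [h [S [hSO hv gv]]] := SO_frame v.
pose E : 'M[R]_(k + m.+1, k) := col_mx 1%:M 0.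
have vE : v = h^T *m E *m S.
  rewrite -mulmxA; have <- : h *m v = E *m S by rewrite hv mul_col_mx mul1mx mul0mx.
  by rewrite mulmxA (mulmx1C hSO.1) mul1mx.
pose A := [set M : 'M[R]_(k + m.+1) | gram (W *m M^T *m E) * gram v <= y].
have mA : <<s @rects (k + m.+1) >> A.
  have : measurable (A : set (g_sigma_algebraType (@rects (k + m.+1)))).
    apply: (@measurable_le_cst _ (g_sigma_algebraType (@rects (k + m.+1)))
      (fun M => gram (W *m M^T *m E) * gram v)).
    apply: measurable_funM; last exact: measurable_cst.
    apply: (@measurable_gram_rot _ (g_sigma_algebraType (@rects (k + m.+1))) _ _ W E id).
    move=> i j _ B mB; rewrite setTI; apply: sub_sigma_algebra.
    exists (fun a b => if (a == i) && (b == j) then B else setT); split.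
      by move=> a b; case: ifP.
    apply/seteqP; split => M /=.
      by move=> h1 a b; case: ifP => // /andP[/eqP -> /eqP ->].
    by move=> /(_ i j); rewrite !eqxx.
  by [].
have [_ _ ->] := haar_law hg hSO mA; congr (P _).
have eqv w : gram (W *m (g w)^T *m v) = gram (W *m (h *m g w)^T *m E) * gram v.
  by rewrite trmx_mul gv {1}vE !mulmxA gramM.
by apply/seteqP; split => w; rewrite /A /= eqv.
Qed.

Lemma sum_prob_le (d : measure_display) (Omega : measurableType d)
    (P : probability Omega R) (T1 T2 : Type) (s : seq T1) (t : seq T2)
    (A : T1 -> set Omega) (B : T2 -> set Omega) (c : R) :
  (forall i, measurable (A i)) -> (forall j, measurable (B j)) -> 0 <= c ->
  (forall w, \sum_(i <- s) \1_(A i) w <= c * \sum_(j <- t) \1_(B j) w) ->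
  (\sum_(i <- s) P (A i) <= c%:E * \sum_(j <- t) P (B j))%E.
Proof.
move=> mA mB c0 h.
have E (T : Type) (u : seq T) (F : T -> set Omega) : (forall i, measurable (F i)) ->
    (\int[P]_w (\sum_(i <- u) \1_(F i) w)%:E = \sum_(i <- u) P (F i))%E.
  move=> mF; under eq_integral do rewrite -sumEFin.
  rewrite ge0_integral_sum//.
  - by apply: eq_bigr => i _; rewrite integral_indic// setIT.
  - by move=> i; apply/measurable_EFinP; exact: measurable_indic.
rewrite -!E// -ge0_integralZl//.
- apply: ge0_le_integral => //.
  + by move=> w _; rewrite lee_fin sumr_ge0.
  + apply/measurable_EFinP; apply: measurable_sum => i; exact: measurable_indic.
  + apply: measurable_funeM; apply/measurable_EFinP.
    by apply: measurable_sum => i; exact: measurable_indic.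
  + by move=> w _; rewrite -EFinM lee_fin.
- by apply/measurable_EFinP; apply: measurable_sum => i; exact: measurable_indic.
- by move=> w _; rewrite lee_fin sumr_ge0.
Qed.

Lemma measure_bigsetU_le (d : measure_display) (T : measurableType d)
    (mu : {measure set T -> \bar R}) (I : Type) (s : seq I) (A : I -> set T) :
  (forall i, measurable (A i)) ->
  (mu (\big[setU/set0]_(i <- s) A i) <= \sum_(i <- s) mu (A i))%E.
Proof.
move=> mA; elim: s => [|i s IH]; first by rewrite !big_nil measure0.
have mB : measurable (\big[setU/set0]_(j <- s) A j) by apply: bigsetU_measurable.
rewrite !big_cons; apply: (@le_trans _ _ (mu (A i) + mu (\big[setU/set0]_(j <- s) A j))%E).
  exact: measureU2.
exact: leeD2l.
Qed.

End Haar.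

(** * Bounding determinants by covers *)

Section Body.
Variable R : realType.
Local Notation toR := (map_mx (@intmul R 1)).

(** Rescaling the box to a unit cube puts differences of points in a ball of squared radius [N],
    where [ball_count] applies. The condition on the columns says that the lattice is fine enough to
    have its basis in this ball. *)
Lemma box_lattice_count N (W : 'M[R]_N) (x0 a b : 'cV[R]_N) (q : nat) (s : seq 'cV[int]_N) :
  \det W != 0 -> (0 < N)%N -> (0 < q)%N -> (forall i, a i 0 < b i 0) -> uniq s ->
  (forall i, sqn (col i (diag_mx (\row_i (b i 0 - a i 0)^-1) *m W)) <= N%:R * q%:R ^+ 2) ->
  (forall n, n \in s -> box a b (x0 + q%:R^-1 *: (W *m toR n))) ->
  (size s)%:R * `|\det W| <= (3 * N)%:R ^+ N * q%:R ^+ N * box_vol a b.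
Proof.
move=> dW N0 q0 ab us hq hs.
have qR : 0 < q%:R :> R by rewrite ltr0n.
pose V := diag_mx (\row_i (b i 0 - a i 0)^-1) *m W.
pose G := q%:R^-1 *: V.
have volE : box_vol a b = \prod_i (b i 0 - a i 0).
  by apply: eq_bigr => i _; rewrite max_l// subr_ge0 ltW.
have vol0 : 0 < box_vol a b by rewrite volE prodr_gt0// => i _; rewrite subr_gt0.
have detG : \det G = (q%:R ^+ N * box_vol a b)^-1 * \det W.
  rewrite /G detZ /V det_mulmx det_diag invfM -exprVn mulrA volE; congr (_ * _ * _).
  by rewrite -prodfV; apply: eq_bigr => i _; rewrite mxE.
have dG : \det G != 0.
  by rewrite detG mulf_neq0// invr_eq0 gt_eqF// mulr_gt0// exprn_gt0.
case: s us hs => [|n0 s0] us hs.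
  by rewrite mul0r; apply: mulr_ge0; [rewrite mulr_ge0 ?exprn_ge0|exact: ltW].
set s := n0 :: s0 in us hs *.
pose s' := [seq n - n0 | n <- s].
have us' : uniq s' by rewrite map_inj_uniq//; exact: addIr.
have hG i : sqn (col i G) <= N%:R.
  have -> : col i G = q%:R^-1 *: col i V by apply/matrixP => p r; rewrite !mxE.
  by rewrite sqnZ exprVn ler_pdivrMl ?exprn_gt0// mulrC.
have hs' x : x \in s' -> sqn (G *m toR x) <= N%:R.
  move=> /mapP[n ns ->].
  apply: (@le_trans _ _ (\sum_(i < N) 1)); last by rewrite sumr_const card_ord.
  apply: ler_sum => i _; rewrite -[leLHS]real_normK ?num_real// expr_le1//.
  have -> : (G *m toR (n - n0)) i 0 =
      ((x0 + q%:R^-1 *: (W *m toR n)) i 0 - (x0 + q%:R^-1 *: (W *m toR n0)) i 0) /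
      (b i 0 - a i 0).
    rewrite /G -scalemxAl /V -mulmxA raddfB/= mulmxBr.
    move: (W *m toR n) (W *m toR n0) => u v; rewrite mul_diag_mx !mxE.
    by rewrite [RHS]mulrC mulrCA; congr (_ * _); ring.
  have := hs n ns i; have := hs n0 (mem_head _ _) i.
  move: ((x0 + _) i 0) ((x0 + _) i 0) => u v /andP[u1 u2] /andP[v1 v2].
  have abi : 0 < b i 0 - a i 0 by rewrite subr_gt0.
  rewrite normrM normfV (gtr0_norm abi) ler_pdivrMr// mul1r ler_norml.
  by apply/andP; split; lra.
have := ball_count dG us' (ler0n _ _) hG hs'; rewrite size_map detG.
move=> bc; have L0 : 0 < q%:R ^+ N * box_vol a b by rewrite mulr_gt0// exprn_gt0.
rewrite -mulrA; set L := q%:R ^+ N * box_vol a b in bc L0 *.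
rewrite -(ler_pXn2r (n := 2)) ?nnegrE ?mulr_ge0 ?exprn_ge0 ?(ltW vol0)//.
rewrite exprMn real_normK ?num_real// exprMn.
move: bc; rewrite exprMn exprVn mulrCA -ler_pdivlMl ?invr_gt0 ?exprn_gt0// invrK => bc.
apply: le_trans bc _; rewrite mulrC ler_wpM2r ?sqr_ge0//.
rewrite -exprM [(N * 2)%N]mulnC exprM -exprMn; apply: lerXn2r; rewrite ?nnegrE ?exprn_ge0//.
by rewrite -!natrX -natrM ler_nat; nia.
Qed.

(** The [q ^ N] grid points of the parallelepiped are shared out among the boxes; [q ^ N]
    cancels. *)
Lemma det_le_finite_cover N (W : 'M[R]_N) (x0 : 'cV[R]_N) n (a b : 'I_n -> 'cV[R]_N) :
  (0 < N)%N -> (forall l i, a l i 0 < b l i 0) ->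
  (forall c : 'cV[R]_N, (forall i, 0 <= c i 0 <= 1) -> exists l, box (a l) (b l) (x0 + W *m c)) ->
  `|\det W| <= (3 * N)%:R ^+ N * \sum_l box_vol (a l) (b l).
Proof.
move=> N0 ab cov.
have vol0 l : 0 <= box_vol (a l) (b l).
  by apply: prodr_ge0 => i _; rewrite le_max lexx orbT.
have [d0|dW] := eqVneq (\det W) 0.
  by rewrite d0 normr0 mulr_ge0 ?exprn_ge0// sumr_ge0.
pose V l := diag_mx (\row_i (b l i 0 - a l i 0)^-1) *m W.
(* The mesh is chosen fine relative to every box at once. *)
pose q := (Num.bound (\sum_l \sum_i sqn (col i (V l)))).+1.
have qV l i : sqn (col i (V l)) <= N%:R * q%:R ^+ 2.
  have s0 : 0 <= \sum_l \sum_i sqn (col i (V l)).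
    by apply: sumr_ge0 => ? _; apply: sumr_ge0 => ? _; apply: sqn_ge0.
  apply: (@le_trans _ _ (\sum_l \sum_i sqn (col i (V l)))).
    rewrite (bigD1 l)//= (bigD1 i)//= -addrA lerDl addr_ge0 ?sumr_ge0// => *.
      exact: sqn_ge0.
    by apply: sumr_ge0 => ? _; apply: sqn_ge0.
  apply: (@le_trans _ _ q%:R).
    by apply: le_trans (ltW (archi_boundP s0)) _; rewrite ler_nat.
  by rewrite -natrX -natrM ler_nat; move: N0; rewrite /q; clear; nia.
have qR : 0 < q%:R :> R by rewrite ltr0n.
pose pt (f : {ffun 'I_N -> 'I_q}) : 'cV[int]_N := \col_i (f i : nat)%:Z.
have pt_inj : injective pt.
  move=> f f' /matrixP e; apply/ffunP => i; apply: val_inj.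
  by have := e i 0; rewrite !mxE => -[].
pose s := map pt (enum {: {ffun 'I_N -> 'I_q}}).
have us : uniq s by rewrite map_inj_uniq ?enum_uniq.
have ss : size s = (q ^ N)%N by rewrite size_map -cardE card_ffun !card_ord.
have /choice[p hp] : forall m : 'cV[int]_N, exists l, m \in s ->
    box (a l) (b l) (x0 + q%:R^-1 *: (W *m toR m)).
  have [l0 _] : exists l : 'I_n, True.
    by have [|l _] := cov 0; [move=> i; rewrite mxE lexx ler01 | exists l].
  move=> m; have [/mapP[f _ ->]|_] := boolP (m \in s); last by exists l0.
  have [|l hl] := cov (q%:R^-1 *: toR (pt f)).
    move=> i; rewrite !mxE -pmulrn mulr_ge0 ?invr_ge0//= ler_pdivrMl// mulr1 ler_nat.
    exact: ltnW.
  by exists l => _; rewrite scalemxAr.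
have main l : (count (fun m => p m == l) s)%:R * `|\det W| <=
    (3 * N)%:R ^+ N * q%:R ^+ N * box_vol (a l) (b l).
  rewrite -size_filter; apply: (@box_lattice_count _ _ x0) => //.
  - by rewrite filter_uniq.
  - exact: qV.
  - by move=> m; rewrite mem_filter => /andP[/eqP <- ms]; apply: hp.
rewrite -(ler_pM2l (_ : 0 < q%:R ^+ N)) ?exprn_gt0//.
have -> : q%:R ^+ N = (size s)%:R :> R by rewrite ss natrX.
rewrite {1}(size_sum_count p s) natr_sum mulr_suml.
rewrite ss natrX mulrA [q%:R ^+ N * _]mulrC mulr_sumr.
by apply: ler_sum => l _; apply: main.
Qed.

Lemma prod_perturb n (l : 'I_n -> R) (e : R) : (forall i, 0 <= l i) -> 0 < e ->
  exists2 t, 0 < t & \prod_i (l i + t) <= \prod_i l i + e.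
Proof.
elim: n l e => [|n IH] l e l0 e0.
  by exists 1 => //; rewrite !big_ord0 lerDl ltW.
have l0' i : 0 <= l (lift ord0 i) by [].
have [t t0 ht] := IH (fun i => l (lift ord0 i)) 1 l0' ltr01.
have [|t1 t10 ht1] := IH (fun i => l (lift ord0 i)) (e / (2 * (l ord0 + 1))) l0'.
  by rewrite divr_gt0// mulr_gt0// ltr_wpDl.
set p := \prod_i l (lift ord0 i) in ht ht1.
have p0 : 0 <= p by apply: prodr_ge0.
pose u := Num.min (Num.min t t1) (e / (2 * (p + 1))).
have u0 : 0 < u by rewrite !lt_min t0 t10 divr_gt0// mulr_gt0// ltr_wpDl.
exists u => //; rewrite !big_ord_recl -/p.
have mono v : u <= v -> \prod_i (l (lift ord0 i) + u) <= \prod_i (l (lift ord0 i) + v).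
  by move=> uv; apply: ler_prod => i _; rewrite lerD2l uv addr_ge0// ltW.
have ut : u <= t by rewrite !ge_min lexx.
have ut1 : u <= t1 by rewrite !ge_min lexx orbT.
have ue : u <= e / (2 * (p + 1)) by rewrite !ge_min lexx !orbT.
have h1 := le_trans (mono _ ut) ht; have h2 := le_trans (mono _ ut1) ht1.
set P := \prod_i _ in h1 h2 *.
have a1 : l ord0 * P <= l ord0 * p + e / 2.
  apply: le_trans (ler_wpM2l (l0 _) h2) _; rewrite mulrDr lerD2l.
  have p1 : 0 < l ord0 + 1 by rewrite ltr_wpDl.
  rewrite mulrA ler_pdivrMr ?mulr_gt0//.
  have -> : e / 2 * (2 * (l ord0 + 1)) = (l ord0 + 1) * e by field.
  by rewrite ler_wpM2r ?(ltW e0)// lerDl.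
have a2 : u * P <= e / 2.
  apply: le_trans (ler_wpM2l (ltW u0) h1) _.
  have p1 : 0 < p + 1 by rewrite ltr_wpDl.
  apply: le_trans (ler_wpM2r (ltW p1) ue) _.
  have -> : e / (2 * (p + 1)) * (p + 1) = e / 2 by field; rewrite gt_eqF.
  by [].
by rewrite mulrDl; lra.
Qed.

Lemma open_forall_seq (T : topologicalType) (I : eqType) (r : seq I) (Q : I -> set T) :
  (forall i, open (Q i)) -> open [set y | forall i, i \in r -> Q i y].
Proof.
move=> oQ; elim: r => [|i r IH].
  by rewrite (_ : [set _ | _] = setT) ?predeqE//; exact: openT.
have -> : [set y | forall j, j \in i :: r -> Q j y] =
    Q i `&` [set y | forall j, j \in r -> Q j y].
  apply/seteqP; split => y /=.
    by move=> h; split => [|j jr]; apply: h; rewrite inE ?eqxx// jr orbT.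
  by move=> [h1 h2] j; rewrite inE => /orP[/eqP ->|/h2].
exact: openI.
Qed.

Lemma affine_continuous N (W : 'M[R]_N) (x0 : 'cV[R]_N) i :
  continuous (fun y : 'rV[R]_N => (x0 + W *m y^T) i 0).
Proof.
have -> : (fun y : 'rV[R]_N => (x0 + W *m y^T) i 0) =
    (fun y => x0 i 0 + \sum_j W i j * y 0 j).
  apply/funext => y; rewrite !mxE; congr (_ + _).
  by apply: eq_bigr => j _; rewrite mxE.
have h (r : seq 'I_N) : continuous (fun z : 'rV[R]_N => \sum_(j <- r) W i j * z 0 j).
  elim: r => [|j r IH] y.
    rewrite (_ : (fun z => _) = (fun=> 0)); last by apply/funext => z; rewrite big_nil.
    exact: cst_continuous.
  rewrite (_ : (fun z => _) = (fun z : 'rV[R]_N => W i j * z 0 j + \sum_(j <- r) W i j * z 0 j));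
    last by apply/funext => z; rewrite big_cons.
  have c1 : (fun z : 'rV[R]_N => W i j * z 0 j) z @[z --> y] --> W i j * y 0 j.
    exact: (@cvgM R 'rV[R]_N (nbhs y) (nbhs_filter y) (fun=> W i j) (fun z => z 0 j) _ _
      (cvg_cst (W i j)) (@coord_continuous R 1 N 0 j y)).
  exact: (@cvgD R R 'rV[R]_N (nbhs y) (nbhs_filter y) (fun z => W i j * z 0 j) _ _ _ c1 (IH y)).
move=> y.
exact: (@cvgD R R 'rV[R]_N (nbhs y) (nbhs_filter y) (fun=> x0 i 0) _ _ _
  (cvg_cst (x0 i 0)) (h _ y)).
Qed.

(** Each box is enlarged to an open one, and compactness of the unit cube leaves finitely many. The
    added volumes [2^-1 ^+ k] sum to at most 2. *)
Lemma det_le_cover N (W : 'M[R]_N) (x0 : 'cV[R]_N) (a b : nat -> 'cV[R]_N) (v : R) :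
  (0 < N)%N ->
  (forall c : 'cV[R]_N, (forall i, 0 <= c i 0 <= 1) ->
     (\bigcup_k box (a k) (b k)) (x0 + W *m c)) ->
  (\sum_(0 <= k <oo) (box_vol (a k) (b k))%:E <= v%:E)%E ->
  `|\det W| <= (3 * N)%:R ^+ N * (v + 2).
Proof.
move=> N0 cov hv.
have /choice[t ht] : forall k, exists t : R, 0 < t /\
    \prod_i (Num.max (b k i 0 - a k i 0) 0 + t) <= box_vol (a k) (b k) + 2^-1 ^+ k.
  move=> k; have [||t t0 h] := @prod_perturb N (fun i => Num.max (b k i 0 - a k i 0) 0) (2^-1 ^+ k).
  - by move=> i; rewrite le_max lexx orbT.
  - by rewrite exprn_gt0// invr_gt0.
  - by exists t.
pose a' k : 'cV[R]_N := \col_i (a k i 0 - t k / 2).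
(* Sides are measured by the maximum with 0, so a box with [b k < a k] in some coordinate also
   becomes a proper box. *)
pose b' k : 'cV[R]_N := \col_i (a k i 0 + Num.max (b k i 0 - a k i 0) 0 + t k / 2).
pose O k := [set y : 'rV[R]_N | forall i, i \in enum 'I_N ->
  [set y : 'rV[R]_N | a' k i 0 < (x0 + W *m y^T) i 0 < b' k i 0] y].
have oO k : open (O k).
  apply: open_forall_seq => i.
  have -> : [set y : 'rV[R]_N | a' k i 0 < (x0 + W *m y^T) i 0 < b' k i 0] =
    (fun y : 'rV[R]_N => (x0 + W *m y^T) i 0) @^-1` [set` `]a' k i 0, b' k i 0[].
    by apply/seteqP; split => y /=; rewrite in_itv.
  apply: (@open_comp 'rV[R]_N R (fun y => (x0 + W *m y^T) i 0) `]a' k i 0, b' k i 0[%classic).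
    by move=> y _; exact: affine_continuous.
  exact: itv_open.
pose Q := [set y : 'rV[R]_N | forall i, `[0, 1]%classic (y ord0 i)].
have cQ : compact Q.
  exact: (@rV_compact R N (fun=> `[0, 1]%classic) (fun=> @segment_compact R 0 1)).
have QO : Q `<=` cover setT O.
  move=> y Qy; have [|k _ hk] := cov y^T.
    by move=> i; have := Qy i; rewrite /= in_itv/= mxE.
  exists k => // i _; have := hk i; have [t0 _] := ht k.
  rewrite /= [a' k i 0]mxE [b' k i 0]mxE.
  move: ((x0 + W *m y^T) i 0) => z /andP[h1 h2].
  set mx := Num.max _ _.
  have : b k i 0 - a k i 0 <= mx by rewrite le_max lexx.
  by move=> h3; apply/andP; split; lra.
rewrite compact_cover in cQ.
have [D' _ hD'] := cQ nat setT O (fun k _ => oO k) QO.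
pose n := (\max_(k <- finmap.enum_fset D') k).+1.
have Dn k : k \in finmap.enum_fset D' -> (k < n)%N.
  by move=> kD; rewrite ltnS (big_rem k)//= leq_maxl.
apply: le_trans (@det_le_finite_cover N W x0 n (fun l => a' l) (fun l => b' l) N0 _ _) _.
- move=> l i; rewrite !mxE; have [t0 _] := ht l.
  have m0 : 0 <= Num.max (b l i 0 - a l i 0) 0 by rewrite le_max lexx orbT.
  by clear hv; lra.
- move=> c hc; have [|k /= kD hk] := hD' c^T.
    by move=> i /=; rewrite in_itv/= mxE.
  exists (Ordinal (Dn k kD)) => i /=; have := hk i; rewrite mem_enum => /(_ isT) /=.
  by rewrite trmxK => /andP[/ltW -> /ltW ->].
rewrite ler_wpM2l ?exprn_ge0//.
apply: (@le_trans _ _ (\sum_(l < n) (box_vol (a l) (b l) + 2^-1 ^+ l))).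
  apply: ler_sum => l _; have [t0 h] := ht l; apply: le_trans h.
  rewrite /box_vol le_eqVlt; apply/orP; left; apply/eqP; apply: eq_bigr => i _.
  have m0 : 0 <= Num.max (b l i 0 - a l i 0) 0 by rewrite le_max lexx orbT.
  rewrite !mxE; set mx := Num.max (b l i 0 - a l i 0) 0 in m0 *.
  have -> : a l i 0 + mx + t l / 2 - (a l i 0 - t l / 2) = mx + t l by field.
  by rewrite max_l// addr_ge0// ltW.
rewrite big_split/= lerD ?sum_half_le2//.
rewrite -lee_fin; apply: le_trans hv.
have vol0 k : (0 <= (box_vol (a k) (b k))%:E)%E.
  by rewrite lee_fin; apply: prodr_ge0 => i _; rewrite le_max lexx orbT.
apply: le_trans (nneseries_lim_ge n (fun k _ _ => vol0 k)).
by rewrite big_mkord sumEFin.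
Qed.

End Body.

(** * Convex bodies in parallelepipeds *)

Section Frame.
Variable R : realType.

Lemma convex_simplex N (T : set 'cV[R]_N) (x0 : 'cV[R]_N) (w : 'I_N -> 'cV[R]_N) :
  convexRN T -> T x0 -> (forall j, T (x0 + w j)) ->
  forall (J : seq 'I_N) (c : 'I_N -> R), (forall j, 0 <= c j) -> \sum_(j <- J) c j <= 1 ->
  T (x0 + \sum_(j <- J) c j *: w j).
Proof.
move=> cT Tx Tw; elim=> [|j J IH] c c0; first by rewrite !big_nil addr0.
rewrite !big_cons => cs.
have s0 : 0 <= \sum_(l <- J) c l by apply: sumr_ge0.
have [l1|l1] := ltP (c j) 1.
  have p : 0 < 1 - c j by rewrite subr_gt0.
  have := IH (fun l => c l / (1 - c j)) _ _.
  rewrite -mulr_suml ler_pdivrMr// mul1r lerBrDl => /(_ _ cs) h.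
  have {}h : T (x0 + \sum_(l <- J) c l / (1 - c j) *: w l).
    by apply: h => l; rewrite divr_ge0// ltW.
  have := cT _ _ (c j) (Tw j) h (c0 j) (ltW l1); congr T.
  rewrite !scalerDr addrACA -scalerDl (_ : c j + (1 - c j) = 1) ?scale1r; last by ring.
  congr (_ + (_ + _)).
  rewrite scaler_sumr; apply: eq_bigr => l _; rewrite scalerA; congr (_ *: _).
  by field; rewrite gt_eqF.
have cj1 : c j = 1 by lra.
have : \sum_(l <- J) c l == 0 by apply/eqP; lra.
rewrite psumr_eq0// => /allP h.
rewrite (eq_big_seq (fun=> 0)) ?big1 ?addr0 ?cj1 ?scale1r//.
by move=> l lJ; have /eqP -> := h l lJ; rewrite scale0r.
Qed.

(** The parallelepiped of [W] shrunk by [N] lies in the simplex, hence the factor [N%:R ^+ N]. In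
    [c + 3], 1 is the slack of the infimum and 2 that of [det_le_cover]. *)
Lemma det_simplex_le N (T : set 'cV[R]_N) (x0 : 'cV[R]_N) (c : R) (W : 'M[R]_N) :
  (0 < N)%N -> convexRN T -> (lebesgue_outerRN T <= c%:E)%E -> T x0 ->
  (forall j, T (x0 + col j W)) ->
  `|\det W| <= N%:R ^+ N * ((3 * N)%:R ^+ N * (c + 3)).
Proof.
move=> N0 cT lT Tx TW.
have NR : 0 < N%:R :> R by rewrite ltr0n.
have : (lebesgue_outerRN T < (c + 1)%:E)%E.
  by apply: le_lt_trans lT _; rewrite lte_fin ltrDl.
move=> /ereal_inf_lt[_ [a [b [cov ->]]] /ltW hv].
have := @det_le_cover R N (N%:R^-1 *: W) x0 a b (c + 1) N0 _ hv.
rewrite detZ normrM normrX normfV (gtr0_norm NR) exprVn.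
rewrite ler_pdivrMl ?exprn_gt0// -addrA (_ : 1 + 2 = 3) => [h|]; last by lra.
apply: h => u hu; apply: cov.
have -> : N%:R^-1 *: W *m u = \sum_(j <- index_enum 'I_N) (u j 0 / N%:R) *: col j W.
  apply/matrixP => i j; rewrite ord1 summxE -scalemxAl !mxE mulr_sumr.
  by apply: eq_bigr => l _; rewrite !mxE; ring.
apply: (@convex_simplex N T x0 (fun j => col j W)) => //.
  by move=> j; have /andP[h _] := hu j; rewrite divr_ge0.
rewrite -mulr_suml ler_pdivrMr// mul1r.
apply: (@le_trans _ _ (\sum_(j < N) 1)); last by rewrite sumr_const card_ord.
by apply: ler_sum => j _; have /andP[] := hu j.
Qed.

Lemma body_frame N (T : set 'cV[R]_N) (x0 : 'cV[R]_N) (c B : R) :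
  (0 < N)%N -> 0 < c -> convexRN T -> (lebesgue_outerRN T <= c%:E)%E -> T x0 ->
  (forall x, T x -> forall i, `|x i 0| <= B) ->
  exists W : 'M[R]_N,
  [/\ \det W != 0, `|\det W| <= N%:R ^+ N * ((3 * N)%:R ^+ N * (c + 3)) + 1 &
      forall x, T x -> exists2 u : 'cV[R]_N, x = x0 + W *m u & forall i, `|u i 0| <= 2].
Proof.
move=> N0 c0 cT lT Tx hB.
set D1 := N%:R ^+ N * ((3 * N)%:R ^+ N * (c + 3)).
have D10 : 0 <= D1 by rewrite !mulr_ge0 ?exprn_ge0//; lra.
pose M := N%:R * (2 * B) ^+ 2 + 1.
have M1 : 1 <= M by rewrite lerDr mulr_ge0 ?sqr_ge0.
have M0 : 0 < M by lra.
(* Admissible edges have squared length at most [M]. By Hadamard, one tiny edge then makes the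
   squared determinant at most [e ^+ 2 * M ^+ N = e <= 1]; hence the [+ 1] in the bound. *)
pose e := (M ^+ N)^-1.
have e0 : 0 < e by rewrite invr_gt0 exprn_gt0.
have e1 : e <= 1 by rewrite invf_le1 ?exprn_gt0// exprn_ege1.
pose Cs := [set w : 'cV[R]_N | T (x0 + w) \/ exists i, w = e *: delta_mx i 0].
have sq_delta i : sqn (e *: delta_mx i 0 : 'cV[R]_N) = e ^+ 2.
  rewrite sqnZ /sqn (bigD1 i)//= big1 ?addr0; last first.
    by move=> j ji; rewrite mxE (negbTE ji) expr0n.
  by rewrite mxE !eqxx expr1n mulr1.
have CsM w : Cs w -> sqn w <= M.
  move=> [Tw|[i ->]]; last first.
    by rewrite sq_delta; apply: le_trans M1; rewrite expr_le1// ltW.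
  apply: (@le_trans _ _ (\sum_(i < N) (2 * B) ^+ 2)); last first.
    by rewrite sumr_const card_ord -[_ *+ N]mulr_natl lerDl.
  apply: ler_sum => i _; rewrite -[leLHS]real_normK ?num_real//.
  have h1 := hB _ Tw i; have h2 := hB _ Tx i.
  have B0 : 0 <= B by apply: le_trans h2.
  apply: lerXn2r; rewrite ?nnegrE ?mulr_ge0//.
  have -> : w i 0 = (x0 + w) i 0 - x0 i 0 by rewrite mxE addrC addKr.
  by apply: le_trans (ler_normB _ _) _; lra.
pose E := [set z : R | exists2 W : 'M[R]_N, forall j, Cs (col j W) & z = `|\det W|].
have ubE : ubound E (D1 + 1).
  move=> _ [W hW ->].
  have [allT|] := pselect (forall j, T (x0 + col j W)).
    by have := @det_simplex_le N T x0 c W N0 cT lT Tx allT; rewrite -/D1; lra.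
  move=> /existsNP[j nTj].
  have [//|[i hi]] := hW j.
  suff : `|\det W| <= 1 by lra.
  rewrite -(ler_pXn2r (n := 2)) ?nnegrE// real_normK ?num_real// expr1n -gram_sq.
  apply: le_trans (hadamard _ (leqnn _)) _.
  rewrite (bigD1 j)//= hi sq_delta.
  have h : \prod_(l < N | l != j) sqn (col l W) <= M ^+ N.
    apply: (@le_trans _ _ (\prod_(l < N | l != j) M)).
      by apply: ler_prod => l _; rewrite sqn_ge0 CsM.
    have -> : M ^+ N = \prod_(l < N) M by rewrite prodr_const card_ord.
    rewrite [leRHS](bigD1 j)//= ler_peMl//.
    by apply: prodr_ge0 => l _; exact: ltW.
  apply: le_trans (ler_wpM2l (sqr_ge0 _) h) _.
  rewrite expr2 -mulrA /e mulVf ?mulr1// gt_eqF// exprn_gt0//.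
have EeN : E (e ^+ N).
  exists (e%:M : 'M[R]_N); last by rewrite det_scalar ger0_norm// exprn_ge0// ltW.
  move=> j; right; exists j; apply/matrixP => p q; rewrite ord1 !mxE eqxx andbT.
  by case: (_ == _); rewrite ?mulr1 ?mulr0.
have hE : has_sup E by split; [exists (e ^+ N)|exists (D1 + 1)].
have supE : 0 < sup E.
  by apply: lt_le_trans (ub_le_sup _ EeN); [rewrite exprn_gt0|case: hE].
have [|_ [W hW ->] hlt] := @sup_adherent _ E (sup E / 2) _ hE; first by lra.
have dW0 : 0 < `|\det W| by lra.
exists W; split.
- by rewrite -normr_gt0.
- by apply: ubE; exists W.
move=> x Ex.
have uW : W \in unitmx by rewrite unitmxE unitfE -normr_gt0.
pose u := invmx W *m (x - x0).
have Wu : W *m u = x - x0 by rewrite /u mulKVmx.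
exists u; first by rewrite Wu addrC subrK.
move=> i.
pose W' := W *m (\matrix_(a, b) if b == i then u a 0 else (a == b)%:R).
have W'E j : col j W' = if j == i then x - x0 else col j W.
  rewrite /W' col_mulmx; case: eqP => [->|/eqP ji].
    by rewrite -Wu; congr (_ *m _); apply/matrixP => p q; rewrite ord1 !mxE eqxx.
  rewrite [RHS]colE; congr (_ *m _); apply/matrixP => p q.
  by rewrite ord1 !mxE (negbTE ji) eqxx andbT.
have : `|\det W'| <= sup E.
  apply: ub_le_sup; first by case: hE.
  exists W' => // j; rewrite W'E; case: ifP => _; last exact: hW.
  by left; rewrite addrC subrK.
rewrite /W' det_mulmx det_id_replace_col normrM => h.
have : `|\det W| * `|u i 0| <= `|\det W| * 2 by lra.
by rewrite ler_pM2l.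
Qed.

End Frame.

(** * The probability of a small sublattice *)

Section RankEvent.
Variable R : realType.
Local Notation toR := (map_mx (@intmul R 1)).

Lemma equivZ_sym n k (v v' : 'M[int]_(n, k)) : equivZ v v' -> equivZ v' v.
Proof. by move=> [U uU ->]; exists (invmx U); rewrite ?unitmx_inv// mulmxK. Qed.

Lemma equivZ_trans n k (v1 v2 v3 : 'M[int]_(n, k)) :
  equivZ v1 v2 -> equivZ v2 v3 -> equivZ v1 v3.
Proof.
move=> [U uU ->] [V uV ->]; exists (U *m V); first by rewrite unitmx_mul uU.
by rewrite mulmxA.
Qed.

Lemma gram_equivZ n m k (G : 'M[R]_(m, n)) (v v' : 'M[int]_(n, k)) :
  equivZ v v' -> gram (G *m toR v') = gram (G *m toR v).
Proof.
move=> [U uU ->]; rewrite map_mxM mulmxA gramM.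
by rewrite -[\det _ ^+ 2]real_normK ?num_real// unitmx_int_det// expr1n mulr1.
Qed.

(** A longest inequivalent list meets every class: otherwise it could be extended. It provides
    finitely many representatives for the union bound and the expectations. *)
Lemma maximal_inequiv_list n k (Q : 'M[int]_(n, k) -> Prop) (b : nat) :
  (forall s : seq 'M[int]_(n, k), uniq s ->
     (forall v v', v \in s -> v' \in s -> equivZ v v' -> v = v') ->
     (forall v, v \in s -> Q v) -> (size s <= b)%N) ->
  exists s : seq 'M[int]_(n, k),
  [/\ uniq s, forall v v', v \in s -> v' \in s -> equivZ v v' -> v = v',
      forall v, v \in s -> Q v & forall v, Q v -> exists2 v', v' \in s & equivZ v' v].
Proof.
move=> hb.
pose good (s : seq 'M[int]_(n, k)) := [/\ uniq s,
  forall v v', v \in s -> v' \in s -> equivZ v v' -> v = v' &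
  forall v, v \in s -> Q v].
pose Pn m := `[< exists2 s, good s & size s = m >].
have ex : exists m, Pn m by exists 0%N; apply/asboolP; exists [::].
have bd m : Pn m -> (m <= b)%N by move=> /asboolP[s [u1 u2 u3] <-]; exact: hb.
case: (ex_maxnP ex bd) => m /asboolP[s [us is_ Qs] sm] mx.
exists s; split => // v Qv; apply: contrapT => nex.
have nv v' : v' \in s -> ~ equivZ v' v by move=> v's e; apply: nex; exists v'.
have : Pn m.+1.
  apply/asboolP; exists (v :: s); last by rewrite /= sm.
  split.
  - rewrite /= us andbT; apply/negP => vs; apply: (nv v vs).
    by exists 1%:M; rewrite ?unitmx1 ?mulmx1.
  - move=> v1 v2; rewrite !inE => /orP[/eqP ->|v1s] /orP[/eqP ->|v2s] // e.
    + by case: (nv _ v2s); apply: equivZ_sym.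
    + by case: (nv _ v1s).
    + exact: is_.
  - by move=> v1; rewrite inE => /orP[/eqP ->|/Qs].
by move=> /mx; rewrite ltnn.
Qed.

Lemma sum_indicE (T Omega : Type) (s : seq T) (B : T -> set Omega) (w : Omega) :
  \sum_(v <- s) \1_(B v) w = (size [seq v <- s | `[< B v w >]])%:R :> R.
Proof.
rewrite size_filter -sum1_count natr_sum [RHS]big_mkcond /=; apply: eq_bigr => v _.
by case: asboolP => h; rewrite indicE; [rewrite mem_set | rewrite memNset].
Qed.

(** The shape of [G] affects only the threshold [a0]; the constant depends on [G] through [D]
    alone. *)
Lemma ball_count_scaled n (G : 'M[R]_n) (a0 D : R) : 0 < a0 -> 0 < D ->
  \det G != 0 -> 1 <= `|\det G| * D -> (forall i, sqn (col i G) <= a0 ^+ 2) ->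
  forall (a : R) (t : seq 'cV[int]_n), a0 <= a -> uniq t ->
     (forall x, x \in t -> sqn (G *m toR x) <= a ^+ 2) ->
     (size t)%:R <= 3 ^+ n * D * a ^+ n.
Proof.
move=> a00 D0 dG hD hc a t ha ut ht.
have a_ge0 : 0 <= a by apply: le_trans ha; exact: ltW.
have := ball_count dG ut (sqr_ge0 a) _ ht.
have hca i : sqn (col i G) <= a ^+ 2.
  by apply: le_trans (hc i) _; apply: lerXn2r; rewrite ?nnegrE// ltW.
move=> /(_ hca) bc.
have {}bc : (size t)%:R * `|\det G| <= 3 ^+ n * a ^+ n.
  rewrite -(ler_pXn2r (n := 2)) ?nnegrE ?mulr_ge0 ?exprn_ge0//.
  rewrite exprMn real_normK ?num_real//; apply: le_trans bc _.
  rewrite -[3 ^+ n * a ^+ n]exprMn -[leRHS]exprM [(n * 2)%N]mulnC exprM -exprMn.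
  by rewrite (_ : (3 * a) ^+ 2 = 9 * a ^+ 2)//; ring.
apply: (@le_trans _ _ ((size t)%:R * (`|\det G| * D))); first by rewrite ler_peMr.
by rewrite mulrA [leRHS]mulrAC; apply: ler_wpM2r => //; exact: ltW.
Qed.

(** Put [q ^+ 2 = phi w]. After invariance, the events at a fixed [w] ask for classes of Z^N of
    covolume at most [y / q] and [Y / q]; the first are at most [Cc * (y / q) ^+ N], the second at
    least [c * (Y / q) ^+ N], and [q] drops out of the comparison. In expectation the second count
    may be taken back to the rotated lattice, where it is at most [Cc * Y ^+ N]. Then [Y]
    cancels. *)
Lemma rank_event k m (D : R) : 0 < D -> exists2 C : R, 0 < C &
  forall (d : measure_display) (Omega : measurableType d)
         (P : probability Omega R) (g : Omega -> 'M[R]_(k.+1 + m.+1)) (W : 'M[R]_(k.+1 + m.+1)),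
  haar_SO P g -> \det W != 0 -> `|\det W| <= D ->
  forall y : R, 0 < y ->
  exists E : set Omega, [/\ measurable E,
    [set w | exists v : 'M[int]_(k.+1 + m.+1, k.+1),
       gram (toR v) != 0 /\ gram (invmx W *m (g w)^T *m toR v) <= y ^+ 2] `<=` E &
    (P E <= (C * y ^+ (k.+1 + m.+1))%:E)%E].
Proof.
move=> D0.
pose K := k.+1; pose N := (k.+1 + m.+1)%N.
have N0 : (0 < N)%N by [].
have KN' : (K <= N)%N by apply: leq_addr.
have KN : (0 < K <= N)%N by [].
(* With [D + 1] a single constant [Cc] serves both Z^N and the lattices of determinant at least
   [D^-1]. *)
have C10 : 0 < 3 ^+ N * (D + 1) by rewrite mulr_gt0 ?exprn_gt0//; lra.
have [Cc Cc0 hCc] := @class_count R N k (3 ^+ N * (D + 1)) N0 C10.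
have [c c0 hc] := @lower_count R N K KN.
exists (Cc * Cc / c); first by rewrite divr_gt0// mulr_gt0.
move=> d Omega P g W hg dW WD y y0.
have [gSO mg _] := hg.
have uW : W \in unitmx by rewrite unitmxE unitfE.
pose A := invmx W.
have AW : W *m A = 1%:M by rewrite mulmxV.
have gg w : (g w)^T *m g w = 1%:M by apply: mulmx1C; case: (gSO w).
have ggT w : ((g w)^T)^T *m (g w)^T = 1%:M by rewrite trmxK; case: (gSO w).
have oW0 := opn_ge0 W; have oA0 := opn_ge0 A.
have cnt1 (X : R) (s : seq 'M[int]_(N, K)) : 0 < X -> uniq s ->
    (forall v v', v \in s -> v' \in s -> equivZ v v' -> v = v') ->
    (forall v, v \in s -> gram (toR v) != 0 /\ gram (toR v) <= X ^+ 2) ->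
    (size s)%:R <= Cc * X ^+ N.
  move=> X0 us is_ hs; apply: (hCc 1%:M 1 ltr01) => //.
  - apply: ball_count_scaled; rewrite ?det1 ?oner_eq0 ?normr1 ?mul1r//; try lra.
    move=> i; rewrite expr1n colE mul1mx /sqn (bigD1 i)//= big1 ?addr0.
      by rewrite mxE !eqxx expr1n.
    by move=> j ji; rewrite mxE (negbTE ji) expr0n.
  - by move=> v /hs[]; rewrite mul1mx.
  - by move=> v /hs[]; rewrite mul1mx.
  - move=> v n vs n0; rewrite expr1n mul1mx; apply: sqn_toR_ge1.
    have [gv _] := hs v vs; apply: contraNneq n0 => h; apply/eqP.
    have : toR n = 0.
      by apply: (gram_inj gv); rewrite -map_mxM h mulmx0 raddf0.
    by move=> /matrixP e; apply/matrixP => i j; have := e i j; rewrite !mxE => /eqP;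
      rewrite intr_eq0 => /eqP.
(* Balls of radius at least [a0] contain all columns of [A *m (g w)^T]. A vector of length at least
   [M] keeps length at least [a0] under this matrix, because [W] inverts [A]. *)
pose a0 := 1 + opn A.
have a00 : 0 < a0 by rewrite /a0; lra.
pose M := (1 + opn W) * a0.
have [X0 hX0] := hc M.
(* [phi w] is at most [opn A ^+ K], so this [Y] makes [Y / q] exceed [X0] for every [w]. *)
pose Y := (1 + `|X0|) * (1 + opn A ^+ K).
have hi0 : 0 <= opn A ^+ K by rewrite exprn_ge0.
have Y0 : 0 < Y by apply: mulr_gt0; [have := normr_ge0 X0; lra | lra].
(* Since [phi w] is bounded below, [X1] dominates [Y / q] for every [w]; [X2] likewise bounds the
   covolumes relevant to the event. Hence lists [F] and [S] independent of [w]. *)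
pose X1 := Y * (1 + opn W ^+ K).
have oWK : 0 <= opn W ^+ K by rewrite exprn_ge0.
have X10 : 0 < X1 by apply: mulr_gt0 => //; lra.
pose X2 := y * (1 + opn W ^+ K).
have X20 : 0 < X2 by apply: mulr_gt0 => //; lra.
have finite_bound (X : R) (Q : 'M[int]_(N, K) -> Prop) : 0 < X ->
    (forall v, Q v -> gram (toR v) != 0 /\ gram (toR v) <= X ^+ 2) ->
    forall s : seq 'M[int]_(N, K), uniq s ->
     (forall v v', v \in s -> v' \in s -> equivZ v v' -> v = v') ->
     (forall v, v \in s -> Q v) -> (size s <= Num.bound (Cc * X ^+ N))%N.
  move=> X0' hQ s us is_ Qs.
  have h := cnt1 X s X0' us is_ (fun v vs => hQ v (Qs v vs)).
  have p : 0 <= Cc * X ^+ N by apply: le_trans h.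
  by rewrite -(ler_nat R); apply: le_trans h _; apply/ltW/archi_boundP.
pose QS (v : 'M[int]_(N, K)) := gram (toR v) != 0 /\ gram (toR v) <= X2 ^+ 2.
have [S [uS iS QSS coverS]] := maximal_inequiv_list (finite_bound X2 QS X20 (fun v h => h)).
pose QF (v : 'M[int]_(N, K)) := (gram (toR v) != 0 /\ gram (toR v) <= X1 ^+ 2) /\
  forall n : 'cV[int]_K, n != 0 -> M ^+ 2 <= sqn (toR (v *m n)).
have [F [uF iF QFF coverF]] := maximal_inequiv_list (finite_bound X1 QF X10 (fun v h => h.1)).
pose ES (v : 'M[int]_(N, K)) := [set w | gram (A *m (g w)^T *m toR v) <= y ^+ 2].
pose EF (v : 'M[int]_(N, K)) := [set w | gram (A *m (g w)^T *m toR v) <= Y ^+ 2].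
pose phi w := gram (A *m (g w)^T *m col_mx 1%:M (0 : 'M[R]_(m.+1, K))).
pose ES' (v : 'M[int]_(N, K)) := [set w | phi w * gram (toR v) <= y ^+ 2].
pose EF' (v : 'M[int]_(N, K)) := [set w | phi w * gram (toR v) <= Y ^+ 2].
have mphi : measurable_fun setT phi by apply: measurable_gram_rot.
have mES v : measurable (ES v) by apply: measurable_le_cst; apply: measurable_gram_rot.
have mEF v : measurable (EF v) by apply: measurable_le_cst; apply: measurable_gram_rot.
have mES' v : measurable (ES' v).
  by apply: measurable_le_cst; apply: measurable_funM => //; exact: measurable_cst.
have mEF' v : measurable (EF' v).
  by apply: measurable_le_cst; apply: measurable_funM => //; exact: measurable_cst.
have PES v : P (ES v) = P (ES' v) by apply: haar_gram.
have PEF v : P (EF v) = P (EF' v) by apply: haar_gram.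
have gramW w (v : 'M[R]_(N, K)) : gram v <= opn W ^+ K * gram (A *m (g w)^T *m v).
  rewrite -(gram_orth v (ggT w)) -[(g w)^T *m v]mul1mx -AW -mulmxA [A *m (_ *m _)]mulmxA.
  exact: gram_mulmx_le.
have gE : gram (col_mx 1%:M (0 : 'M[R]_(m.+1, K))) = 1 by rewrite gram_col_mx0 det1 expr1n.
have phi_lo w : 1 <= opn W ^+ K * phi w by rewrite -gE; exact: gramW.
have phi_hi w : phi w <= opn A ^+ K.
  rewrite /phi -mulmxA; apply: le_trans (gram_mulmx_le _ _ KN' KN') _.
  by rewrite gram_orth// gE mulr1.
have phi0 w : 0 < phi w by have := phi_lo w; nra.
have pt1 w : \sum_(v <- S) \1_(ES' v) w <=
    (Cc / c * (y / Y) ^+ N) * \sum_(v <- F) \1_(EF' v) w.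
  pose q := Num.sqrt (phi w).
  have q0 : 0 < q by rewrite sqrtr_gt0.
  have q2 : q ^+ 2 = phi w by rewrite sqr_sqrtr// ltW.
  rewrite !sum_indicE.
  have hS : (size [seq v <- S | `[< ES' v w >]])%:R <= Cc * (y / q) ^+ N.
    apply: cnt1; first exact: divr_gt0.
    - by rewrite filter_uniq.
    - by move=> v v'; rewrite !mem_filter => /andP[_ vS] /andP[_ v'S]; exact: iS.
    - move=> v; rewrite mem_filter => /andP[/asboolP hv vS]; split; first by case: (QSS v vS).
      by rewrite expr_div_n q2 ler_pdivlMr// mulrC.
  have XY : X0 <= Y / q.
    rewrite ler_pdivlMr//; apply: (@le_trans _ _ (`|X0| * (1 + opn A ^+ K))).
      apply: le_trans (ler_wpM2r (ltW q0) (ler_norm X0)) _; apply: ler_wpM2l => //.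
      rewrite -(ler_pXn2r (n := 2)) ?nnegrE ?(ltW q0)//; last by lra.
      by rewrite q2; apply: le_trans (phi_hi w) _; nra.
    by rewrite ler_wpM2r//; lra.
  have [s0 [us0 szs0 is0 gs0 sh0]] := hX0 _ XY.
  have XX1 : (Y / q) ^+ 2 <= X1 ^+ 2.
    rewrite expr_div_n q2 ler_pdivrMr//.
    have -> : X1 ^+ 2 * phi w = Y ^+ 2 * ((1 + opn W ^+ K) ^+ 2 * phi w).
      by rewrite /X1; ring.
    apply: ler_peMr; first exact: sqr_ge0.
    move: (phi_lo w) (phi0 w) oWK; move: (opn W ^+ K) (phi w); clear => o f; nra.
  have /choice[f hf] : forall v, exists v', v \in s0 -> v' \in F /\ equivZ v' v.
    move=> v; have [vs|_] := boolP (v \in s0); last by exists v.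
    have [|v' v'F e] := coverF v; last by exists v'.
    split; last by move=> n n0; exact: sh0.
    by have [g1 g2] := gs0 v vs; split => //; apply: le_trans XX1.
  have hF : c * (Y / q) ^+ N <= (size [seq v <- F | `[< EF' v w >]])%:R.
    apply: le_trans szs0 _; rewrite ler_nat -(size_map f); apply: uniq_leq_size.
      rewrite map_inj_in_uniq// => v v' vs v's e.
      apply: is0 => //; have [_ e1] := hf v vs; have [_ e2] := hf v' v's.
      by apply: equivZ_trans (equivZ_sym e1) _; rewrite e.
    move=> _ /mapP[v vs ->]; rewrite mem_filter; have [-> e] := hf v vs; rewrite andbT.
    apply/asboolP; rewrite /EF' /=.
    have := gram_equivZ 1%:M e; rewrite !mul1mx => <-.
    have [_] := gs0 v vs; rewrite expr_div_n q2 ler_pdivlMr// => h.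
    by rewrite mulrC.
  apply: le_trans hS _.
  have -> : Cc * (y / q) ^+ N = Cc / c * (y / Y) ^+ N * (c * (Y / q) ^+ N).
    have -> : Cc / c * (y / Y) ^+ N * (c * (Y / q) ^+ N) = Cc * ((y / Y) * (Y / q)) ^+ N.
      rewrite [(_ / _ * (_ / _)) ^+ N]exprMn.
      by move: ((y / Y) ^+ N) ((Y / q) ^+ N) => u1 u2; field; rewrite gt_eqF.
    by rewrite mulrA divfK// gt_eqF.
  rewrite ler_wpM2l// mulr_ge0 ?exprn_ge0 ?divr_ge0 ?ltW//.
(* The constant bound is written as a one-term sum over the sure event, to fit [sum_prob_le].
   Classes in [F] have no short vectors, so [class_count] applies with threshold [a0]. *)
have pt2 w : \sum_(v <- F) \1_(EF v) w <= Cc * Y ^+ N * \sum_(u <- [:: tt]) \1_[set: Omega] w.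
  rewrite big_seq1 indicE in_setT mulr1 sum_indicE.
  have detAg : `|\det (A *m (g w)^T)| = `|\det W|^-1.
    rewrite det_mulmx det_inv det_tr normrM normfV.
    by have [_ ->] := gSO w; rewrite normr1 mulr1.
  have dWp : 0 < `|\det W| by rewrite normr_gt0.
  apply: (hCc (A *m (g w)^T) a0 a00) => //.
  - apply: ball_count_scaled => //; first by lra.
    + by rewrite -normr_gt0 detAg invr_gt0.
    + by rewrite detAg ler_pdivlMl// mulr1; lra.
    + move=> i; rewrite col_mulmx; apply: le_trans (sqn_mulmx_le _ _) _.
      have -> : sqn (col i (g w)^T) = 1.
        rewrite colE sqn_orth// /sqn (bigD1 i)//= big1 ?addr0.
          by rewrite mxE !eqxx expr1n.
        by move=> j ji; rewrite mxE (negbTE ji) expr0n.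
      by rewrite mulr1 /a0; nra.
  - by rewrite filter_uniq.
  - by move=> v v'; rewrite !mem_filter => /andP[_ vS] /andP[_ v'S]; exact: iF.
  - move=> v; rewrite mem_filter => /andP[_ vF]; have [[gv _] _] := QFF v vF.
    apply: contraNneq gv => g0; have := gramW w (toR v); rewrite g0 mulr0 => h.
    by apply/eqP; apply/le_anti; rewrite h gram_ge0.
  - by move=> v; rewrite mem_filter => /andP[/asboolP].
  - move=> v n; rewrite mem_filter => /andP[_ vF] n0; have [_ sh] := QFF v vF.
    have h1 := sh n n0.
    have h2 : sqn (toR (v *m n)) <= opn W * sqn (A *m (g w)^T *m toR (v *m n)).
      have <- : sqn (W *m (A *m (g w)^T *m toR (v *m n))) = sqn (toR (v *m n)).
        by rewrite !mulmxA AW mul1mx sqn_orth.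
      exact: sqn_mulmx_le.
    have h3 := sqn_ge0 (A *m (g w)^T *m toR (v *m n)).
    have h4 := le_trans h1 h2; rewrite /M exprMn in h4.
    set z := sqn _ in h3 h4 *.
    rewrite leNgt; apply/negP => h5.
    have a2 : 0 < a0 ^+ 2 by rewrite exprn_gt0.
    by move: (a0 ^+ 2) a2 h4 h5 h3 => u u0 h4 h5 h3; move: oW0 h4; move: (opn W) => o; nra.
exists (\bigcup_(v in [set` S]) ES v); split.
- by apply: fin_bigcup_measurable => //; exact: finite_seq.
- move=> w [v [gv hv]].
  have [|v' v'S e] := coverS v.
    split => //; apply: le_trans (gramW w (toR v)) _.
    apply: (@le_trans _ _ (opn W ^+ K * y ^+ 2)); first by rewrite ler_wpM2l.
    by rewrite /X2 exprMn mulrC ler_wpM2l ?sqr_ge0//; nra.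
  exists v' => //; rewrite /ES /=.
  by rewrite -(gram_equivZ _ e).
have P1 : (P (\bigcup_(v in [set` S]) ES v) <= \sum_(v <- S) P (ES v))%E.
  rewrite bigcup_seq; exact: measure_bigsetU_le.
apply: (le_trans P1).
rewrite (eq_bigr (fun v => P (ES' v))); last by move=> v _; exact: PES.
have c1 : 0 <= Cc / c * (y / Y) ^+ N by rewrite mulr_ge0 ?exprn_ge0 ?divr_ge0 ?ltW.
apply: le_trans (sum_prob_le P mES' mEF' c1 pt1) _.
rewrite (eq_bigr (fun v => P (EF v))); last by move=> v _; rewrite PEF.
have c2 : 0 <= Cc * Y ^+ N by rewrite mulr_ge0 ?exprn_ge0 ?ltW.
have h := sum_prob_le P mEF (fun _ : unit => measurableT) c2 pt2.
rewrite big_seq1 probability_setT mule1 in h.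
apply: le_trans (lee_wpmul2l _ h) _; first by rewrite lee_fin.
rewrite -EFinM lee_fin le_eqVlt; apply/orP; left; apply/eqP.
have YN : Y ^+ N != 0 by rewrite expf_neq0// gt_eqF.
rewrite expr_div_n -/N; move: (Y ^+ N) YN (y ^+ N) => u1 u10 u2; field.
by rewrite u10 gt_eqF.
Qed.

End RankEvent.

(** * Conclusion *)

Section Main.
Variable R : realType.
Local Notation toR := (map_mx (@intmul R 1)).

Lemma rank_event_lt N k (D : R) : (k.+1 < N)%N -> 0 < D -> exists2 C : R, 0 < C &
  forall (d : measure_display) (Omega : measurableType d)
         (P : probability Omega R) (g : Omega -> 'M[R]_N) (W : 'M[R]_N),
  haar_SO P g -> \det W != 0 -> `|\det W| <= D ->
  forall y : R, 0 < y ->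
  exists E : set Omega, [/\ measurable E,
    [set w | exists v : 'M[int]_(N, k.+1),
       gram (toR v) != 0 /\ gram (invmx W *m (g w)^T *m toR v) <= y ^+ 2] `<=` E &
    (P E <= (C * y ^+ N)%:E)%E].
Proof.
move=> kN D0; have E : N = (k.+1 + (N - k.+2).+1)%N by lia.
by move: (N - k.+2)%N E => m E; subst N; exact: rank_event.
Qed.

Lemma lattice_ptE N (z : 'cV[R]_N) : is_lattice_pt z -> toR (\col_i Num.floor (z i 0)) = z.
Proof.
by move=> hz; apply/matrixP => i j; rewrite ord1 !mxE; apply: floorK.
Qed.

(** Differences of points have coordinates at most 4 after pulling back, so squared length at most
    16N, and 144 is 9 times 16. Rank 0 means that there is a single point. *)
Lemma many_lattice_pts_rank N (g W : 'M[R]_N) (T : set 'cV[R]_N) (x0 : 'cV[R]_N) (Kp : R) :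
  (0 < N)%N -> SOset g -> \det W != 0 -> 0 < Kp ->
  (forall x, T x -> exists2 u : 'cV[R]_N, x = x0 + W *m u & forall i, `|u i 0| <= 2) ->
  many_lattice_pts g T Kp ->
  exists k (v : 'M[int]_(N, k)), [/\ (k = 0%N -> Kp <= 1),
    gram (toR v) != 0, 0 < gram (invmx W *m g^T *m toR v) &
    Kp ^+ 2 * gram (invmx W *m g^T *m toR v) <= (144 * N)%:R ^+ k].
Proof.
move=> N0 [gg dg] dW Kp0 hT [s [us [hK hs]]].
have uW : W \in unitmx by rewrite unitmxE unitfE.
have gtg : g^T *m g = 1%:M by apply: mulmx1C.
pose ni (z : 'cV[R]_N) : 'cV[int]_N := \col_i Num.floor (z i 0).
have niE z : z \in s -> toR (ni z) = z by move=> /hs[/lattice_ptE].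
case: s us hK hs niE => [|z0 s0]; first by rewrite leNgt Kp0.
set s := z0 :: s0 => us hK hs niE.
pose s' := [seq ni z - ni z0 | z <- s].
have us' : uniq s'.
  rewrite map_inj_in_uniq// => z z' zs z's /addIr e.
  by rewrite -(niE z zs) -(niE z' z's) e.
have dG : \det (invmx W *m g^T) != 0.
  by rewrite det_mulmx det_tr dg mulr1 det_inv invr_eq0.
have pull z : z \in s -> exists2 u : 'cV[R]_N, invmx W *m g^T *m z = invmx W *m x0 + u &
    forall i, `|u i 0| <= 2.
  move=> /hs[_ [x Tx <-]]; have [u -> hu] := hT x Tx; exists u => //.
  by rewrite -!mulmxA (mulmxA g^T) gtg mul1mx mulmxDr mulKmx.
have hs' x : x \in s' -> sqn (invmx W *m g^T *m toR x) <= (16 * N)%:R.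
  move=> /mapP[z zs ->]; have z0s : z0 \in s by rewrite mem_head.
  have -> : toR (ni z - ni z0) = z - z0 by rewrite raddfB /= !niE.
  have [u eu hu] := pull z zs; have [u0 eu0 hu0] := pull z0 z0s.
  rewrite mulmxBr eu eu0 opprD addrACA subrr add0r.
  apply: (@le_trans _ _ (\sum_(i < N) 16)); last first.
    by rewrite sumr_const card_ord natrM mulr_natr.
  apply: ler_sum => i _; rewrite -[leLHS]real_normK ?num_real//.
  have -> : 16 = 4 ^+ 2 :> R by rewrite -natrX.
  apply: lerXn2r; rewrite ?nnegrE// !mxE.
  by apply: le_trans (ler_normB _ _) _; have := hu i; have := hu0 i; lra.
have [k [v [gv sz sp]]] := lattice_points dG us' (ler0n _ _) hs'.
exists k, v; split => //.
- move=> k0; apply: le_trans hK _; subst k.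
  rewrite -(size_map (fun z => ni z - ni z0)) -/s' (_ : 1 = 1%:R)// ler_nat.
  apply: (@leq_trans (size [:: (0 : 'cV[int]_N)])) => //; apply: uniq_leq_size => // x xs.
  rewrite inE; apply/eqP/matrixP => i j; rewrite mxE.
  have [c hc] := sp x xs; have /matrixP/(_ i j) := hc; rewrite [LHS]mxE [RHS]mxE big_ord0.
  by move=> /eqP; rewrite intr_eq0 => /eqP.
- by apply: (@gram_mulmx_neq0 _ _ _ _ (invmx W *m g^T)); rewrite gt_eqF.
- rewrite size_map in sz.
  have -> : (144 * N)%:R ^+ k = 9 ^+ k * (16 * N)%:R ^+ k :> R.
    by rewrite -exprMn -natrM mulnA.
  apply: le_trans sz; apply: ler_wpM2r; first exact: ltW.
  by apply: lerXn2r; rewrite ?nnegrE//; exact: ltW.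
Qed.

Lemma bounded_lattice_pts_prob N (c : R) : (0 < N)%N -> 0 < c -> exists2 C : R, 0 < C &
  forall (d : measure_display) (Omega : measurableType d)
         (P : probability Omega R) (g : Omega -> 'M[R]_N) (T : set 'cV[R]_N) (B Kp : R),
  haar_SO P g -> convexRN T -> (lebesgue_outerRN T <= c%:E)%E ->
  (forall x, T x -> forall i, `|x i 0| <= B) -> 1 <= Kp ->
  exists E : set Omega, [/\ measurable E,
    [set w | many_lattice_pts (g w) T Kp] `<=` E & (P E <= (C * Kp ^- N)%:E)%E].
Proof.
move=> N0 c0.
pose D := N%:R ^+ N * ((3 * N)%:R ^+ N * (c + 3)) + 1.
have D1 : 1 <= D by rewrite lerDr !mulr_ge0 ?exprn_ge0//; lra.
have D0 : 0 < D by lra.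
pose Q : R := (144 * N)%:R.
have Q1 : 1 <= Q by rewrite ler1n muln_gt0.
have Q0 : 0 < Q by lra.
have QX1 n : 1 <= Q ^+ n by rewrite exprn_ege1.
have /choice[Cf hCf] : forall k, exists C : R, 0 < C /\ ((k.+1 < N)%N ->
  forall (d : measure_display) (Omega : measurableType d)
         (P : probability Omega R) (g : Omega -> 'M[R]_N) (W : 'M[R]_N),
  haar_SO P g -> \det W != 0 -> `|\det W| <= D ->
  forall y : R, 0 < y ->
  exists E : set Omega, [/\ measurable E,
    [set w | exists v : 'M[int]_(N, k.+1),
       gram (toR v) != 0 /\ gram (invmx W *m (g w)^T *m toR v) <= y ^+ 2] `<=` E &
    (P E <= (C * y ^+ N)%:E)%E]).
  move=> k; have [kN|kN] := ltnP k.+1 N; last by exists 1.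
  by have [C C0 h] := rank_event_lt kN D0; exists C.
have Cf0 k : 0 < Cf k by case: (hCf k).
(* Up to [K0] the bound is trivial with constant [K0 ^+ N]; beyond it the ranks 0 and [N] cannot
   occur. *)
pose K0 := Q ^+ N * D.
have K01 : 1 <= K0 by rewrite -[leLHS]mulr1 ler_pM.
pose S := \sum_(k < N.-1) Cf k * (Q ^+ k.+1) ^+ N.
have S0 : 0 <= S.
  by apply: sumr_ge0 => k _; rewrite mulr_ge0 ?exprn_ge0 ?(ltW (Cf0 _)) ?(ltW Q0).
have K0N : 0 < K0 ^+ N by rewrite exprn_gt0//; lra.
exists (K0 ^+ N + S); first by lra.
move=> d Omega P g T B Kp hg cT lT hB Kp1.
have Kp0 : 0 < Kp by lra.
have [KK0|KK0] := leP Kp K0.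
  exists setT; split => //; rewrite probability_setT lee_fin ler_pdivlMr ?exprn_gt0// mul1r.
  apply: (@le_trans _ _ (K0 ^+ N)); last by rewrite lerDl.
  by apply: lerXn2r; rewrite ?nnegrE//; lra.
have [[x0 Tx0]|nT] := pselect (exists x, T x); last first.
  exists set0; split => //; last first.
    by rewrite measure0 lee_fin mulr_ge0 ?invr_ge0 ?exprn_ge0//; lra.
  move=> w [[|z s] [_ [hK hs]]]; first by move: hK; rewrite leNgt Kp0.
  by have [_ [x Tx _]] := hs z (mem_head _ _); apply: nT; exists x.
have [W [dW WD hW]] := @body_frame R N T x0 c B N0 c0 cT lT Tx0 hB.
have [gSO _ _] := hg.
(* The Gram determinant is at most [Q ^+ k.+1 / Kp ^+ 2]; as [Q >= 1], it is below the square of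
   [Q ^+ k.+1 / Kp], the value of [y] used here. *)
have /choice[E hE] : forall k, exists E : set Omega, measurable E /\ ((k.+1 < N)%N ->
    [set w | exists v : 'M[int]_(N, k.+1),
       gram (toR v) != 0 /\ gram (invmx W *m (g w)^T *m toR v) <= (Q ^+ k.+1 / Kp) ^+ 2]
       `<=` E /\
    (P E <= (Cf k * (Q ^+ k.+1 / Kp) ^+ N)%:E)%E).
  move=> k; have [kN|kN] := ltnP k.+1 N; last by exists set0.
  have [_ /(_ kN d Omega P g W hg dW WD (Q ^+ k.+1 / Kp))] := hCf k.
  by case=> [|E [h1 h2 h3]]; [rewrite divr_gt0// exprn_gt0 | exists E].
exists (\big[setU/set0]_(k < N.-1) E k); split.
- by apply: bigsetU_measurable => k _; case: (hE k).
- move=> w /= hw.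
  have [k [v [k0 gv gp gb]]] := many_lattice_pts_rank N0 (gSO w) dW Kp0 hW hw.
  case: k v k0 gv gp gb => [|k] v k0 gv gp gb.
    by have := k0 erefl; lra.
  have kN := gram_neq0_leq gv.
  have [kN'|kN'] := ltnP k.+1 N; last first.
    have EN : k.+1 = N by apply/eqP; rewrite eqn_leq kN kN'.
    exfalso; move: v gv gp gb {k0 kN kN'}; rewrite EN => v gv gp gb.
    (* A full-rank sublattice has covolume at least that of the whole lattice, which is at least
       [D^-1]; this contradicts [Kp > K0]. *)
    have gram1 : (D ^+ 2)^-1 <= gram (invmx W *m (g w)^T *m toR v).
      rewrite gram_sq !det_mulmx det_tr (gSO w).2 mulr1 det_inv det_map_mx exprMn exprVn.
      have dv : 1 <= ((\det v)%:~R : R) ^+ 2.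
        rewrite -rmorphXn /= ler1z.
        have : \det v != 0.
          by apply: contraNneq gv => h; rewrite gram_sq det_map_mx h rmorph0 expr0n.
        by move=> h; have : 0 < \det v ^+ 2 by rewrite exprn_even_gt0.
      have dW2 : 0 < \det W ^+ 2 by rewrite exprn_even_gt0.
      have i1 : (D ^+ 2)^-1 <= (\det W ^+ 2)^-1.
        rewrite lef_pV2 ?posrE ?dW2 ?(exprn_gt0 2 D0)// -[leLHS]real_normK ?num_real//.
        by apply: lerXn2r; rewrite ?nnegrE//; exact: ltW.
      by apply: le_trans i1 _; apply: ler_peMr => //; rewrite invr_ge0 sqr_ge0.
    have h1 : Kp ^+ 2 * (D ^+ 2)^-1 <= Q ^+ N.
      by apply: le_trans gb; rewrite ler_wpM2l ?sqr_ge0.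
    rewrite ler_pdivrMr ?exprn_gt0// in h1.
    have h2 : Kp ^+ 2 <= K0 ^+ 2.
      apply: le_trans h1 _; rewrite /K0 exprMn ler_wpM2r ?sqr_ge0//.
      by rewrite expr2 ler_peMl// ltW// exprn_gt0.
    have : K0 ^+ 2 < Kp ^+ 2 by rewrite ltr_pXn2r ?nnegrE//; lra.
    by rewrite ltNge h2.
  rewrite -bigcup_mkord; exists k; first by rewrite /= ltn_predRL.
  have [_ /(_ kN') [hsub _]] := hE k; apply: hsub; exists v; split => //.
  have Kp2 : 0 < Kp ^+ 2 by rewrite exprn_gt0.
  rewrite expr_div_n ler_pdivlMr// mulrC; apply: le_trans gb _.
  by rewrite expr2 ler_peMl// ltW// exprn_gt0.
have mE k : measurable (E k) by case: (hE k).
apply: le_trans (measure_bigsetU_le P _ (fun k : 'I_N.-1 => mE k)) _.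
apply: (@le_trans _ _ (\sum_(k < N.-1) (Cf k * (Q ^+ k.+1 / Kp) ^+ N)%:E)%E).
  apply: lee_sum => k _; have kN : (k.+1 < N)%N by rewrite -ltn_predRL.
  by have [_ /(_ kN) []] := hE k.
rewrite sumEFin lee_fin mulrDl.
apply: (@le_trans _ _ (S * Kp ^- N)).
  rewrite /S mulr_suml; apply: ler_sum => k _.
  by rewrite expr_div_n mulrA.
by rewrite lerDr mulr_ge0 ?invr_ge0 ?exprn_ge0//; lra.
Qed.

End Main.

(** The bounded case has a constant independent of the bound, so [T] is exhausted by its truncations
    to cubes, which are again convex and no larger in outer measure. *)
Theorem theorem4p4 (R : realType) (N : nat) : (1 <= N)%N ->
  forall c : R, 0 < c ->
  exists C : R, 0 < C /\
  forall (d : measure_display) (Omega : measurableType d)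
         (P : probability Omega R) (g : Omega -> 'M[R]_N),
  haar_SO P g ->
  forall T : set 'cV[R]_N, convexRN T -> (lebesgue_outerRN T <= c%:E)%E ->
  forall K : R, 1 <= K ->
  exists E : set Omega, measurable E /\
    [set w | many_lattice_pts (g w) T K] `<=` E /\
    (P E <= (C * K ^- N)%:E)%E.
Proof.
move=> N1 c c0; have [C C0 hC] := bounded_lattice_pts_prob N1 c0.
exists C; split => // d Omega P g hg T cT lT K K1.
pose Tn (n : nat) := [set x : 'cV[R]_N | T x /\ forall i, `|x i 0| <= n%:R].
have cTn n : convexRN (Tn n).
  move=> x y t [Tx hx] [Ty hy] t0 t1; split; first exact: cT.
  move=> i; rewrite !mxE; apply: le_trans (ler_normD _ _) _; rewrite !normrM.
  have t1' : 0 <= 1 - t by rewrite subr_ge0.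
  rewrite (ger0_norm t0) (ger0_norm t1').
  by have := ler_wpM2l t0 (hx i); have := ler_wpM2l t1' (hy i); lra.
have lTn n : (lebesgue_outerRN (Tn n) <= c%:E)%E.
  apply: le_trans lT; apply: le_ereal_inf => _ [a [b [cov ->]]].
  by exists a, b; split => // x [/cov].
have /choice[E hE] : forall n, exists E : set Omega, [/\ measurable E,
    [set w | many_lattice_pts (g w) (Tn n) K] `<=` E & (P E <= (C * K ^- N)%:E)%E].
  by move=> n; apply: (hC d Omega P g (Tn n) n%:R K) => // x [].
(* The union of the [F n] is the lower limit of the [E m]. A finite list of points of the rotated
   [T] comes from all large truncations, so it is covered, and continuity from below preserves the
   bound, as [F n] is contained in [E n]. *)
pose F n := \bigcap_(m in [set m | (n <= m)%N]) E m.
have mF n : measurable (F n).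
  by apply: bigcap_measurable => [|m _]; [exists n => /= | case: (hE m)].
have mbF : measurable (\bigcup_n F n) by apply: bigcupT_measurable.
exists (\bigcup_n F n); split => //; split.
- move=> w [s [us [hK hs]]].
  have [gSO _ _] := hg.
  have gtg : (g w)^T *m g w = 1%:M by apply: mulmx1C; case: (gSO w).
  pose b : R := \sum_(z <- s) \sum_i `|((g w)^T *m z) i 0|.
  have b0 : 0 <= b by apply: sumr_ge0 => z _; apply: sumr_ge0.
  exists (Num.bound b) => // m /= bm; have [_ + _] := hE m; apply.
  exists s; split => //; split => // z zs; have [hz [x Tx xz]] := hs z zs.
  split => //; exists x => //; split => // i.
  have -> : x = (g w)^T *m z by rewrite -xz mulmxA gtg mul1mx.
  apply: (@le_trans _ _ b); last first.
    by apply: le_trans (ltW (archi_boundP b0)) _; rewrite ler_nat.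
  rewrite /b (big_rem z zs)/= (bigD1 i)//= -addrA lerDl addr_ge0//.
    by apply: sumr_ge0.
  by apply: sumr_ge0 => z' _; apply: sumr_ge0.
- have ndF : {homo F : n m / (n <= m)%N >-> (n <= m)%O}.
    move=> n m nm; apply/subsetPset => w Fw l /= ml; apply: Fw => /=.
    exact: leq_trans ml.
  have cv : (P \o F) n @[n --> \oo] --> P (\bigcup_n F n) by exact: nondecreasing_cvg_mu.
  rewrite -(cvg_lim _ cv)//; apply: lime_le.
    by apply/cvg_ex; exists (P (\bigcup_n F n)).
  apply: nearW => n /=; have [mEn _ hPn] := hE n; apply: le_trans hPn.
  by apply: le_measure; rewrite ?inE//; move=> w Fw; apply: Fw => /=.
Qed.
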